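(* Consider the case $\eta\equiv\kappa$. Then for each pair $(V_-,V_+)\in\mathbb{R}^2$ and each $E_0>\frac12\max\{V_-^2,V_+^2\}$ there exists a unique solution $(V,W)$, with $V:\mathbb{R}\to\mathbb{R}$ and $W:\mathbb{R}\to[0,\infty[$, of the ODE system $$-\frac y2 V'(y)=\big(\eta(W)V'\big)'(y),\qquad -\frac y2 W'(y)=\big(\kappa(W)W'\big)'(y)+\eta(W(y))\,(V'(y))^2\qquad\text{for } y\in\mathbb{R},$$ satisfying $$V(y)\to V_{\pm}\ \text{ for } y\to\pm\infty\qquad\text{and}\qquad W(y)+\tfrac12V(y)^2=E_0\ \text{ for all } y\in\mathbb{R}.$$ In particular, if $V_-\neq V_+$, then $y\mapsto V(y)$ is strictly monotone and $W(y)>E_0-\frac12\max\{V_-^2,V_+^2\}>0$ for all $y\in\mathbb{R}$.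
   Context: The function $\eta=\kappa:[0,\infty[\to[0,\infty[$ is continuous with $\eta(0)=0$, and $\eta$ is positive and locally Lipschitz on $]0,\infty[$ (the prototype is $\eta(w)=\eta_0w^\alpha$ with $\eta_0,\alpha>0$). Solutions are understood in the classical sense: $V,W\in C^1(\mathbb{R})$ with $\eta(W)V',\ \kappa(W)W'\in C^1(\mathbb{R})$. The ODE system is the equation for profiles of parabolically self-similar solutions $(v(t,x),w(t,x))=(V(x/\sqrt{t+1}),W(x/\sqrt{t+1}))$ of $\partial_tv=(\eta(w)v_x)_x$, $\partial_tw=(\kappa(w)w_x)_x+\eta(w)v_x^2$ on $\mathbb{R}$. *)

(* Defs.v *)
From Stdlib Require Import Reals.
From Coquelicot Require Import Coquelicot.
Open Scope R_scope.

(* A function [0,oo[ -> [0,oo[ is represented by a function R -> R whose values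
   on negative reals are irrelevant: they are not constrained here, and they
   never occur in the system below because W >= 0. *)

Definition locally_lipschitz_pos (eta : R -> R) : Prop :=
  forall w, 0 < w ->
    exists r L, 0 < r /\
      forall x y, 0 < x -> 0 < y -> Rabs (x - w) < r -> Rabs (y - w) < r ->
        Rabs (eta x - eta y) <= L * Rabs (x - y).

Record diffusivity (eta : R -> R) : Prop := {
  diffusivity_nonneg : forall w, 0 <= w -> 0 <= eta w;
  diffusivity_continuous : continuous_on (fun w => 0 <= w) eta;
  diffusivity_zero : eta 0 = 0;
  diffusivity_pos : forall w, 0 < w -> 0 < eta w;
  diffusivity_lipschitz : locally_lipschitz_pos eta
}.

Definition is_C1 (f : R -> R) : Prop :=
  forall y, ex_derive f y /\ continuous (Derive f) y.

Definition flux (eta W U : R -> R) (y : R) : R := eta (W y) * Derive U y.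

Record profile_solution (eta kappa V W : R -> R) : Prop := {
  profile_W_nonneg : forall y, 0 <= W y;
  profile_V_C1 : is_C1 V;
  profile_W_C1 : is_C1 W;
  profile_V_flux_C1 : is_C1 (flux eta W V);
  profile_W_flux_C1 : is_C1 (flux kappa W W);
  profile_V_eq : forall y,
    - (y / 2) * Derive V y = Derive (flux eta W V) y;
  profile_W_eq : forall y,
    - (y / 2) * Derive W y
    = Derive (flux kappa W W) y + eta (W y) * (Derive V y) ^ 2
}.

Record connecting_profile (eta kappa : R -> R) (Vm Vp E0 : R) (V W : R -> R)
  : Prop := {
  connecting_solution : profile_solution eta kappa V W;
  connecting_minus : is_lim V m_infty Vm;
  connecting_plus : is_lim V p_infty Vp;
  connecting_energy : forall y, W y + / 2 * (V y) ^ 2 = E0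
}.

(* Main.v *)
Require Import Defs.
From Stdlib Require Import Reals Ranalysis5 Lra ClassicalEpsilon.
From Coquelicot Require Import Coquelicot.
Open Scope R_scope.

(** The energy identity eliminates [W]: with [a v = eta (E0 - v^2 / 2)] the
    system is equivalent to the scalar equation [- (y / 2) V' = (a (V) V')']
    ([connecting_of_scalar], [scalar_of_connecting]). Write [q = a (V) V'] for
    the flux.

    Every solution is constant or strictly monotone. For [y >= 0] the square
    [q^2] is nonincreasing, so a zero of [W] at such a point, where [q] vanishes,
    would make [W] vanish from there on, against its positive limit; zeros at
    [y <= 0] are excluded by rotating the graph ([scalar_profile_positive]).
    Since [W > 0], the flux solves a linear equation [q' = - (y / (2 a (V))) q]
    and has a constant sign ([scalar_profile_sign]). By the symmetry [V |-> - V]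
    only increasing profiles, with [Vm < Vp], remain to be studied.

    For those the hodograph transformation takes [v = V y] as the independent
    variable. With [q = Q (V)] the equation becomes [Q' (V y) = - y / 2] together
    with the singular boundary value problem [Q'' = - a / (2 Q)],
    [Q Vm = Q Vp = 0], [Q > 0], which turns both existence and uniqueness into
    questions about [Q].

    Existence of [Q] ([singular_solution_exists]). With boundary value [e > 0]
    in place of [0] the problem is a fixed point problem for a contraction in the
    unknown [ln Q] ([lifted_solution_exists]). The right-hand side decreases in
    [Q] in absolute value, so the maximum principle applies: solutions for [e1]
    and [e2] differ by at most [|e1 - e2|], and all lie above a fixed concave
    parabola. Hence they converge uniformly as [e] tends to [0], to a limit that
    solves the equation in the open interval.

    Existence of [V] ([profile_of_hodograph]). The slope [Q'] is strictly
    decreasing, and unbounded at both ends because [Q''] behaves there like minus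
    the inverse of the distance to the boundary, up to a logarithm. So
    [v |-> - 2 Q' v] is a bijection from [(Vm, Vp)] onto the line, and [V] is its
    inverse.

    Uniqueness ([scalar_profile_hodograph]). If [V] is any increasing profile,
    the maximum principle along the line, applied to [q - Q (V)], gives
    [q = Q (V)]. Differentiating, [Q' (V y) = - y / 2], which determines [V y]. *)

(** * Calculus on an interval *)

Lemma continuous_continuity_pt (f : R -> R) (x : R) :
  continuous f x -> continuity_pt f x.
Proof. intros H; apply continuity_pt_filterlim; exact H. Qed.

Lemma is_derive_continuous (f : R -> R) (x l : R) :
  is_derive f x l -> continuous f x.
Proof. intros H; apply (ex_derive_continuous f x); exists l; exact H. Qed.

Lemma mean_value (f f' : R -> R) (a b : R) :
  a < b ->
  (forall x, a < x < b -> is_derive f x (f' x)) ->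
  (forall x, a <= x <= b -> continuous f x) ->
  exists c, a < c < b /\ f b - f a = f' c * (b - a).
Proof.
  intros Hab Hd Hc.
  assert (pr1 : forall c, a < c < b -> derivable_pt f c).
  { intros c Hcc; exists (f' c); apply is_derive_Reals, Hd, Hcc. }
  destruct (MVT f id a b pr1 (fun c _ => derivable_pt_id c)) as (c & P & Heq).
  - exact Hab.
  - intros x Hx; apply continuous_continuity_pt, Hc, Hx.
  - intros x _; apply derivable_continuous_pt, derivable_pt_id.
  - exists c; split; [exact P|].
    rewrite derive_pt_id in Heq; unfold id in Heq.
    rewrite (derive_pt_eq_0 f c (f' c)) in Heq; [lra|].
    apply is_derive_Reals, Hd, P.
Qed.

Lemma nondecreasing_of_derive (f f' : R -> R) (a b : R) :
  a <= b ->
  (forall x, a < x < b -> is_derive f x (f' x) /\ 0 <= f' x) ->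
  (forall x, a <= x <= b -> continuous f x) ->
  f a <= f b.
Proof.
  intros Hab Hd Hc.
  destruct (Req_dec a b) as [->|Hne]; [lra|].
  destruct (mean_value f f' a b) as (c & Hcc & Heq); try assumption; [lra| |].
  - intros x Hx; apply Hd, Hx.
  - assert (0 <= f' c * (b - a)) by (apply Rmult_le_pos; [apply Hd, Hcc|lra]).
    lra.
Qed.

Lemma increasing_of_derive (f f' : R -> R) (a b : R) :
  a < b ->
  (forall x, a < x < b -> is_derive f x (f' x) /\ 0 < f' x) ->
  (forall x, a <= x <= b -> continuous f x) ->
  f a < f b.
Proof.
  intros Hab Hd Hc.
  destruct (mean_value f f' a b) as (c & Hcc & Heq); try assumption.
  - intros x Hx; apply Hd, Hx.
  - assert (0 < f' c * (b - a)) by (apply Rmult_lt_0_compat; [apply Hd, Hcc|lra]).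
    lra.
Qed.

Lemma constant_of_derive (f f' : R -> R) (a b : R) :
  a <= b ->
  (forall x, a < x < b -> is_derive f x (f' x) /\ f' x = 0) ->
  (forall x, a <= x <= b -> continuous f x) ->
  f a = f b.
Proof.
  intros Hab Hd Hc.
  destruct (Req_dec a b) as [->|Hne]; [reflexivity|].
  destruct (mean_value f f' a b) as (c & Hcc & Heq); try assumption; [lra| |].
  - intros x Hx; apply Hd, Hx.
  - rewrite (proj2 (Hd c Hcc)) in Heq; lra.
Qed.

Lemma is_derive_positive_right (E : R -> R) (x e : R) :
  is_derive E x e -> E x = 0 -> 0 < e ->
  exists d, 0 < d /\ forall y, x < y < x + d -> 0 < E y.
Proof.
  intros Hd H0 He.
  apply is_derive_Reals in Hd.
  destruct (Hd (e / 2)) as (d & Hdd); [lra|].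
  exists d; split; [apply cond_pos|].
  intros y Hy.
  assert (Hh : y - x <> 0) by lra.
  assert (Hr : Rabs (y - x) < d) by (rewrite Rabs_pos_eq; lra).
  specialize (Hdd (y - x) Hh Hr).
  replace (x + (y - x)) with y in Hdd by ring.
  rewrite H0 in Hdd; apply Rabs_def2 in Hdd.
  assert (Hq : (E y - 0) / (y - x) > 0) by lra.
  replace (E y) with ((E y - 0) / (y - x) * (y - x)) by (field; lra).
  apply Rmult_lt_0_compat; lra.
Qed.

(** The second derivative test, for a derivative in factored form: [p] is
    continuous and only [E] is differentiated, so [f] may fail to be twice
    differentiable away from [x]. *)
Lemma no_local_max (f p E : R -> R) (x e d : R) :
  0 < d ->
  (forall y, x <= y < x + d ->
     is_derive f y (p y * E y) /\ 0 < p y /\ f y <= f x) ->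
  E x = 0 -> is_derive E x e -> 0 < e -> False.
Proof.
  intros Hd Hf H0 HE He.
  destruct (is_derive_positive_right E x e HE H0 He) as (d' & Hd' & Hpos).
  set (r := Rmin d d' / 2).
  assert (Hr : 0 < r /\ r < d /\ r < d').
  { unfold r; assert (H1 := Rmin_l d d'); assert (H2 := Rmin_r d d').
    assert (0 < Rmin d d') by (apply Rmin_pos; assumption); lra. }
  assert (f x < f (x + r)).
  { apply increasing_of_derive with (f' := fun y => p y * E y); [lra| |].
    - intros y Hy; split; [apply Hf; lra|].
      apply Rmult_lt_0_compat; [apply Hf; lra|apply Hpos; lra].
    - intros y Hy; eapply is_derive_continuous; apply Hf; lra. }
  assert (f (x + r) <= f x) by (apply Hf; lra).
  lra.
Qed.

Lemma exists_max_on (f : R -> R) (a b : R) :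
  a <= b -> (forall x, a <= x <= b -> continuous f x) ->
  exists c, a <= c <= b /\ forall x, a <= x <= b -> f x <= f c.
Proof.
  intros Hab Hc.
  destruct (continuity_ab_maj f a b Hab) as (c & Hm & Hcc).
  - intros x Hx; apply continuous_continuity_pt, Hc, Hx.
  - exists c; split; assumption.
Qed.

Lemma exists_min_on (f : R -> R) (a b : R) :
  a <= b -> (forall x, a <= x <= b -> continuous f x) ->
  exists c, a <= c <= b /\ forall x, a <= x <= b -> f c <= f x.
Proof.
  intros Hab Hc.
  destruct (continuity_ab_min f a b Hab) as (c & Hm & Hcc).
  - intros x Hx; apply continuous_continuity_pt, Hc, Hx.
  - exists c; split; assumption.
Qed.

Lemma interior_max_derive_zero (f : R -> R) (a b c l : R) :
  a < c < b -> is_derive f c l -> (forall x, a < x < b -> f x <= f c) -> l = 0.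
Proof.
  intros Hc Hd Hm.
  assert (pr : derivable_pt f c) by (exists l; apply is_derive_Reals, Hd).
  rewrite <- (derive_pt_eq_0 f c l pr) by (apply is_derive_Reals, Hd).
  apply (deriv_maximum f a b c pr); try lra.
  intros x H1 H2; apply Hm; lra.
Qed.

(** At an interior maximum above the level [delta] the second derivative would
    be both nonpositive and positive. *)
Lemma maximum_principle (D D1 D2 : R -> R) (a b delta : R) :
  a < b ->
  (forall x, a <= x <= b -> continuous D x) ->
  (forall x, a < x < b -> is_derive D x (D1 x)) ->
  (forall x, a < x < b -> is_derive D1 x (D2 x)) ->
  (forall x, a < x < b -> delta < D x -> 0 < D2 x) ->
  D a <= delta -> D b <= delta ->
  forall x, a <= x <= b -> D x <= delta.
Proof.
  intros Hab Hc Hd1 Hd2 Hpos Ha Hb x Hx.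
  destruct (exists_max_on D a b) as (c & Hcab & Hmax); [lra|exact Hc|].
  destruct (Rle_lt_dec (D c) delta) as [Hle|Hgt].
  { specialize (Hmax x Hx); lra. }
  exfalso.
  assert (Hca : a < c < b).
  { split; apply Rnot_le_lt; intros H.
    - assert (c = a) by lra; subst; lra.
    - assert (c = b) by lra; subst; lra. }
  apply (no_local_max D (fun _ => 1) D1 c (D2 c) (b - c)); [lra| | | |].
  - intros y Hy; split; [|split; [lra|apply Hmax; lra]].
    rewrite Rmult_1_l; apply Hd1; lra.
  - apply (interior_max_derive_zero D a b c); [assumption|apply Hd1, Hca|].
    intros; apply Hmax; lra.
  - apply Hd2, Hca.
  - apply Hpos; assumption.
Qed.

Lemma continuous_epsilon (f : R -> R) (x : R) :
  continuous f x <->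
  forall e, 0 < e -> exists d, 0 < d /\
    forall y, Rabs (y - x) < d -> Rabs (f y - f x) < e.
Proof.
  split.
  - intros H e He.
    destruct (proj1 (filterlim_locally f (f x)) H (mkposreal e He)) as (d & Hd).
    exists d; split; [apply cond_pos|].
    intros y Hy; apply Hd; exact Hy.
  - intros H; apply (filterlim_locally f (f x)); intros e.
    destruct (H e (cond_pos e)) as (d & Hd & Hy).
    exists (mkposreal d Hd); intros y Hyy; apply Hy; exact Hyy.
Qed.

Lemma locally_between (p r x : R) :
  p < x < r -> locally x (fun y => p < y < r).
Proof.
  intros Hx.
  assert (Hd : 0 < Rmin (x - p) (r - x)) by (apply Rmin_pos; lra).
  exists (mkposreal _ Hd); intros y Hy.
  apply (Rabs_def2 (y - x)) in Hy; simpl in Hy.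
  assert (H1 := Rmin_l (x - p) (r - x)); assert (H2 := Rmin_r (x - p) (r - x)).
  lra.
Qed.

Lemma is_derive_reflect (f : R -> R) (s x l : R) :
  is_derive f (s - x) l -> is_derive (fun y => f (s - y)) x (- l).
Proof.
  intros H; evar_last.
  - apply (is_derive_comp f (fun y => s - y) x l (0 - 1)); [exact H|].
    apply (is_derive_minus (fun _ => s) (fun y => y) x 0 1);
      [apply (is_derive_const s)|apply (is_derive_id x)].
  - unfold scal; simpl; unfold mult; simpl; ring.
Qed.

Lemma is_derive_comp_opp (f : R -> R) (x l : R) :
  is_derive f (- x) l -> is_derive (fun y => f (- y)) x (- l).
Proof.
  intros H; apply (is_derive_ext (fun y => f (0 - y))).
  - intros y; f_equal; ring.
  - apply is_derive_reflect; replace (0 - x) with (- x) by ring; exact H.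
Qed.

Lemma is_derive_right_inverse (f V : R -> R) (y l : R) :
  (forall z, f (V z) = z) -> continuous V y -> is_derive f (V y) l -> l <> 0 ->
  is_derive V y (/ l).
Proof.
  intros Hinv HV Hf Hl; apply is_derive_Reals; apply is_derive_Reals in Hf.
  intros e He.
  destruct (proj1 (continuous_epsilon Rinv l) (continuous_Rinv l Hl) e He)
    as (d1 & Hd1 & H1).
  destruct (Hf d1 Hd1) as (d2 & H2).
  destruct (proj1 (continuous_epsilon V y) HV d2 (cond_pos d2))
    as (d3 & Hd3 & H3).
  exists (mkposreal d3 Hd3); intros h Hh0 Hh; simpl in Hh.
  assert (Hk : Rabs (V (y + h) - V y) < d2)
    by (apply H3; replace (y + h - y) with h by ring; exact Hh).
  set (k := V (y + h) - V y) in *.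
  assert (Hfk : f (V y + k) - f (V y) = h).
  { unfold k; replace (V y + (V (y + h) - V y)) with (V (y + h)) by ring.
    rewrite !Hinv; ring. }
  assert (Hk0 : k <> 0).
  { intros H; rewrite H, Rplus_0_r in Hfk; lra. }
  specialize (H2 k Hk0 Hk); rewrite Hfk in H2.
  specialize (H1 (h / k) H2).
  replace (k / h) with (/ (h / k)) by (field; auto); exact H1.
Qed.

(** * Uniform limits and contractions *)

Lemma continuous_uniform_limit (u : nat -> R -> R) (f : R -> R) (r : nat -> R) :
  (forall n x, continuous (u n) x) ->
  is_lim_seq r 0 ->
  (forall n x, Rabs (u n x - f x) <= r n) ->
  forall x, continuous f x.
Proof.
  intros Hc Hr Hu x; apply continuous_epsilon; intros e He.
  apply is_lim_seq_spec in Hr.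
  assert (He3 : 0 < e / 3) by lra.
  destruct (Hr (mkposreal _ He3)) as (n & Hn).
  specialize (Hn n (Nat.le_refl n)); simpl in Hn.
  apply Rabs_def2 in Hn.
  destruct (proj1 (continuous_epsilon (u n) x) (Hc n x) (e / 3) He3)
    as (d & Hd & Hy).
  exists d; split; [assumption|]; intros y Hyx.
  specialize (Hy y Hyx).
  assert (H1 := Hu n x); assert (H2 := Hu n y).
  apply Rabs_def2 in Hy.
  apply Rabs_le_between in H1; apply Rabs_le_between in H2.
  apply Rabs_def1; lra.
Qed.

Lemma uniform_cauchy_limit (u : nat -> R -> R) (r : nat -> R) :
  is_lim_seq r 0 ->
  (forall n m x, (n <= m)%nat -> Rabs (u m x - u n x) <= r n) ->
  exists f, forall n x, Rabs (u n x - f x) <= r n.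
Proof.
  intros Hr Hu.
  exists (fun x => real (Lim_seq (fun n => u n x))); intros n x.
  assert (Hf : ex_finite_lim_seq (fun n => u n x)).
  { apply ex_lim_seq_cauchy_corr; intros e.
    apply is_lim_seq_spec in Hr.
    destruct (Hr (pos_div_2 e)) as (N & HN).
    exists N; intros p q Hp Hq; simpl in HN.
    specialize (HN N (Nat.le_refl N)); apply Rabs_def2 in HN.
    assert (H1 := Hu N p x Hp); assert (H2 := Hu N q x Hq).
    apply Rabs_le_between in H1; apply Rabs_le_between in H2.
    apply Rabs_def1; lra. }
  apply Lim_seq_correct' in Hf.
  set (l := real _) in *.
  assert (H : Rbar_le (Rabs (u n x - l)) (r n)).
  { apply (is_lim_seq_le_loc (fun m => Rabs (u n x - u m x)) (fun _ => r n)).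
    - exists n; intros m Hm; rewrite Rabs_minus_sym; apply Hu, Hm.
    - apply (is_lim_seq_abs _ (u n x - l)).
      apply (is_lim_seq_minus' _ _ (u n x) l); [apply is_lim_seq_const|exact Hf].
    - apply is_lim_seq_const. }
  exact H.
Qed.

Lemma lim_of_error (u r : nat -> R) (l C : R) :
  is_lim_seq r 0 -> (forall n, Rabs (u n - l) <= C * r n) -> is_lim_seq u l.
Proof.
  intros Hr Hu.
  assert (HC : is_lim_seq (fun n => C * r n) 0).
  { replace (Finite 0) with (Rbar_mult C 0) by (simpl; f_equal; ring).
    apply is_lim_seq_scal_l, Hr. }
  apply (is_lim_seq_le_le (fun n => l - C * r n) _ (fun n => l + C * r n)).
  - intros n; specialize (Hu n); apply Rabs_le_between in Hu; lra.
  - replace (Finite l) with (Finite (l - 0)) by (f_equal; ring).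
    apply is_lim_seq_minus'; [apply is_lim_seq_const|exact HC].
  - replace (Finite l) with (Finite (l + 0)) by (f_equal; ring).
    apply is_lim_seq_plus'; [apply is_lim_seq_const|exact HC].
Qed.

Lemma le_of_lim_error (u r : nat -> R) (l x : R) :
  is_lim_seq r 0 -> (forall n, Rabs (u n - l) <= r n) -> (forall n, x <= u n) ->
  x <= l.
Proof.
  intros Hr Hu Hx.
  apply (is_lim_seq_le (fun _ => x) u x l); [exact Hx|apply is_lim_seq_const|].
  apply (lim_of_error u r l 1 Hr); intros n; rewrite Rmult_1_l; apply Hu.
Qed.

(** Banach's fixed point theorem for the distance [sup |f - g|], on a class [P]
    of functions closed under uniform limits. *)
Lemma contraction_fixed_point (P : (R -> R) -> Prop) (T : (R -> R) -> R -> R)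
  (k d0 : R) (f0 : R -> R) :
  0 <= k < 1 -> P f0 -> (forall f, P f -> P (T f)) ->
  (forall f g d, P f -> P g -> (forall x, Rabs (f x - g x) <= d) ->
     forall x, Rabs (T f x - T g x) <= k * d) ->
  (forall x, Rabs (T f0 x - f0 x) <= d0) ->
  (forall u f r, (forall n : nat, P (u n)) -> is_lim_seq r 0 ->
     (forall n x, Rabs (u n x - f x) <= r n) -> P f) ->
  exists f, P f /\ forall x, T f x = f x.
Proof.
  intros Hk HP0 HPT HT Hd0 Hclosed.
  set (u := fun n => Nat.iter n T f0).
  assert (HPu : forall n, P (u n)).
  { induction n; [exact HP0|exact (HPT _ IHn)]. }
  assert (Hstep : forall n x, Rabs (u (S n) x - u n x) <= k ^ n * d0).
  { induction n; intros x.
    - simpl; rewrite Rmult_1_l; apply Hd0.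
    - simpl pow; rewrite Rmult_assoc.
      apply (HT (u (S n)) (u n)); auto. }
  assert (Hd0p : 0 <= d0).
  { specialize (Hd0 0); assert (H := Rabs_pos (T f0 0 - f0 0)); lra. }
  set (r := fun n => k ^ n * (d0 / (1 - k))).
  assert (Hr : is_lim_seq r 0).
  { replace (Finite 0) with (Rbar_mult 0 (d0 / (1 - k)))
      by (simpl; f_equal; ring).
    apply is_lim_seq_scal_r, is_lim_seq_geom.
    rewrite Rabs_pos_eq; lra. }
  assert (Hrpos : forall n, 0 <= r n).
  { intros n; unfold r, Rdiv; apply Rmult_le_pos; [apply pow_le; lra|].
    apply Rmult_le_pos; [assumption|].
    left; apply Rinv_0_lt_compat; lra. }
  assert (Hrstep : forall n, r n = k ^ n * d0 + r (S n)).
  { intros n; unfold r; simpl; field; lra. }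
  assert (Hcauchy : forall n m x, (n <= m)%nat -> Rabs (u m x - u n x) <= r n).
  { intros n m x Hnm.
    assert (H : Rabs (u m x - u n x) <= r n - r m).
    { induction Hnm.
      - rewrite Rminus_diag, Rabs_R0; lra.
      - replace (u (S m) x - u n x) with ((u (S m) x - u m x) + (u m x - u n x))
          by ring.
        assert (H1 := Rabs_triang (u (S m) x - u m x) (u m x - u n x)).
        assert (H2 := Hstep m x); assert (H3 := Hrstep m); lra. }
    specialize (Hrpos m); lra. }
  destruct (uniform_cauchy_limit u r Hr Hcauchy) as (f & Hf).
  exists f.
  assert (HPf : P f) by exact (Hclosed u f r HPu Hr Hf).
  split; [exact HPf|]; intros x.
  assert (Hle : Rbar_le (Rabs (T f x - f x)) 0).
  { apply (is_lim_seq_le (fun _ => Rabs (T f x - f x))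
             (fun n => k * r n + r (S n))).
    - intros n.
      assert (H1 : Rabs (T (u n) x - T f x) <= k * r n).
      { apply HT; auto. }
      assert (H2 := Hf (S n) x).
      change (u (S n)) with (T (u n)) in H2.
      apply Rabs_le_between in H1; apply Rabs_le_between in H2.
      apply Rabs_le_between; lra.
    - apply is_lim_seq_const.
    - replace (Finite 0) with (Finite (k * 0 + 0)) by (f_equal; ring).
      apply is_lim_seq_plus'.
      + apply is_lim_seq_scal_l with (lu := Finite 0); exact Hr.
      + apply is_lim_seq_incr_1 in Hr; exact Hr. }
  simpl in Hle; assert (H := Rabs_pos (T f x - f x)).
  assert (H0 : Rabs (T f x - f x) = 0) by lra.
  destruct (Req_dec (T f x - f x) 0) as [E|E]; [lra|].
  apply Rabs_pos_lt in E; lra.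
Qed.

(** * The Green operator of the second derivative *)

Lemma ex_RInt_everywhere_continuous (g : R -> R) (a b : R) :
  (forall x, continuous g x) -> ex_RInt g a b.
Proof. intros Hg; apply (ex_RInt_continuous g a b); intros z _; apply Hg. Qed.

Lemma is_derive_RInt_upper (g : R -> R) (a x : R) :
  (forall y, continuous g y) -> is_derive (fun y => RInt g a y) x (g x).
Proof.
  intros Hg; apply (is_derive_RInt g _ a x); [|apply Hg].
  apply filter_forall; intros y.
  apply (RInt_correct (V := R_CompleteNormedModule)).
  apply ex_RInt_everywhere_continuous, Hg.
Qed.

Lemma is_derive_RInt_lower (g : R -> R) (b x : R) :
  (forall y, continuous g y) -> is_derive (fun y => RInt g y b) x (- g x).
Proof.
  intros Hg; apply (is_derive_RInt' g _ x b); [|apply Hg].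
  apply filter_forall; intros y.
  apply (RInt_correct (V := R_CompleteNormedModule)).
  apply ex_RInt_everywhere_continuous, Hg.
Qed.

(** The solution of [- u'' = g] on [[a, b]] with [u a = u b = 0]. *)
Definition green (a b : R) (g : R -> R) (x : R) : R :=
  ((b - x) * RInt (fun s => (s - a) * g s) a x
   + (x - a) * RInt (fun s => (b - s) * g s) x b) / (b - a).

Definition green_deriv (a b : R) (g : R -> R) (x : R) : R :=
  (RInt (fun s => (b - s) * g s) x b - RInt (fun s => (s - a) * g s) a x)
  / (b - a).

Lemma continuous_sub_mult (g : R -> R) (a : R) :
  (forall x, continuous g x) -> forall x, continuous (fun s => (s - a) * g s) x.
Proof.
  intros Hg x; apply (continuous_mult (fun s => s - a) g); [|apply Hg].
  apply (continuous_minus (fun s : R => s) (fun _ => a));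
    [apply continuous_id|apply continuous_const].
Qed.

Lemma continuous_rsub_mult (g : R -> R) (b : R) :
  (forall x, continuous g x) -> forall x, continuous (fun s => (b - s) * g s) x.
Proof.
  intros Hg x; apply (continuous_mult (fun s => b - s) g); [|apply Hg].
  apply (continuous_minus (fun _ : R => b) (fun s => s));
    [apply continuous_const|apply continuous_id].
Qed.

Section Green.

Variables a b : R.
Hypothesis Hab : a < b.

Lemma is_derive_green (g : R -> R) (x : R) :
  (forall y, continuous g y) ->
  is_derive (green a b g) x (green_deriv a b g x).
Proof.
  intros Hg; unfold green, green_deriv.
  assert (H1 := is_derive_RInt_upper _ a x (continuous_sub_mult g a Hg)).
  assert (H2 := is_derive_RInt_lower _ b x (continuous_rsub_mult g b Hg)).
  set (I1 := (fun y => RInt (fun s => (s - a) * g s) a y) : R -> R) in *.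
  set (I2 := (fun y => RInt (fun s => (b - s) * g s) y b) : R -> R) in *.
  change (is_derive I1 x ((x - a) * g x)) in H1.
  change (is_derive I2 x (- ((b - x) * g x))) in H2.
  change (is_derive (fun y => ((b - y) * I1 y + (y - a) * I2 y) / (b - a)) x
            ((I2 x - I1 x) / (b - a))).
  clearbody I1 I2; auto_derive.
  - repeat split; first [exact (ex_intro _ _ H1)|exact (ex_intro _ _ H2)].
  - apply is_derive_unique in H1; apply is_derive_unique in H2.
    change (Derive (fun y => I1 y) x) with (Derive I1 x).
    change (Derive (fun y => I2 y) x) with (Derive I2 x).
    rewrite H1, H2; field; lra.
Qed.

Lemma is_derive_green_deriv (g : R -> R) (x : R) :
  (forall y, continuous g y) -> is_derive (green_deriv a b g) x (- g x).
Proof.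
  intros Hg; unfold green_deriv.
  assert (H1 := is_derive_RInt_upper _ a x (continuous_sub_mult g a Hg)).
  assert (H2 := is_derive_RInt_lower _ b x (continuous_rsub_mult g b Hg)).
  set (I1 := (fun y => RInt (fun s => (s - a) * g s) a y) : R -> R) in *.
  set (I2 := (fun y => RInt (fun s => (b - s) * g s) y b) : R -> R) in *.
  change (is_derive I1 x ((x - a) * g x)) in H1.
  change (is_derive I2 x (- ((b - x) * g x))) in H2.
  change (is_derive (fun y => (I2 y - I1 y) / (b - a)) x (- g x)).
  clearbody I1 I2; auto_derive.
  - repeat split; first [exact (ex_intro _ _ H1)|exact (ex_intro _ _ H2)].
  - apply is_derive_unique in H1; apply is_derive_unique in H2.
    change (Derive (fun y => I1 y) x) with (Derive I1 x).
    change (Derive (fun y => I2 y) x) with (Derive I2 x).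
    rewrite H1, H2; field; lra.
Qed.

Lemma green_left (g : R -> R) : green a b g a = 0.
Proof.
  unfold green; rewrite RInt_point; unfold zero; simpl; field; lra.
Qed.

Lemma green_right (g : R -> R) : green a b g b = 0.
Proof.
  unfold green; rewrite RInt_point; unfold zero; simpl; field; lra.
Qed.

Lemma green_linear (g h : R -> R) (k l x : R) :
  (forall y, continuous g y) -> (forall y, continuous h y) ->
  green a b (fun s => k * g s + l * h s) x = k * green a b g x + l * green a b h x.
Proof.
  intros Hg Hh; unfold green.
  assert (HI : forall (w : R -> R) c d,
    (forall f : R -> R, (forall y, continuous f y) ->
       forall y, continuous (fun s => w s * f s) y) ->
    RInt (fun s => w s * (k * g s + l * h s)) c d =
    k * RInt (fun s => w s * g s) c d + l * RInt (fun s => w s * h s) c d).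
  { intros w c d Hw.
    assert (Hex : forall f : R -> R, (forall y, continuous f y) ->
      is_RInt (fun s => w s * f s) c d (RInt (fun s => w s * f s) c d)).
    { intros f Hf; apply (RInt_correct (V := R_CompleteNormedModule)).
      apply ex_RInt_everywhere_continuous, Hw, Hf. }
    apply is_RInt_unique.
    apply (is_RInt_ext
             (fun s => plus (scal k (w s * g s)) (scal l (w s * h s)))).
    - intros s _; unfold plus, scal; simpl; unfold mult; simpl; ring.
    - apply (is_RInt_plus (V := R_NormedModule));
        apply (is_RInt_scal (V := R_NormedModule)); apply Hex; assumption. }
  rewrite (HI (fun s => s - a)) by (intros; apply continuous_sub_mult; assumption).
  rewrite (HI (fun s => b - s)) by (intros; apply continuous_rsub_mult; assumption).
  field; lra.
Qed.

Lemma green_le (g h : R -> R) (x : R) :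
  (forall y, continuous g y) -> (forall y, continuous h y) ->
  (forall y, a <= y <= b -> g y <= h y) -> a <= x <= b ->
  green a b g x <= green a b h x.
Proof.
  intros Hg Hh Hle Hx; unfold green, Rdiv.
  apply Rmult_le_compat_r; [left; apply Rinv_0_lt_compat; lra|].
  apply Rplus_le_compat; apply Rmult_le_compat_l; try lra.
  - apply RInt_le; try lra;
      try (apply ex_RInt_everywhere_continuous, continuous_sub_mult; assumption).
    intros s Hs; apply Rmult_le_compat_l; [lra|apply Hle; lra].
  - apply RInt_le; try lra;
      try (apply ex_RInt_everywhere_continuous, continuous_rsub_mult; assumption).
    intros s Hs; apply Rmult_le_compat_l; [lra|apply Hle; lra].
Qed.

Lemma green_nonneg (g : R -> R) (x : R) :
  (forall y, continuous g y) -> (forall y, a <= y <= b -> 0 <= g y) ->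
  a <= x <= b -> 0 <= green a b g x.
Proof.
  intros Hg Hpos Hx; unfold green, Rdiv.
  apply Rmult_le_pos; [|left; apply Rinv_0_lt_compat; lra].
  apply Rplus_le_le_0_compat; apply Rmult_le_pos; try lra; apply RInt_ge_0;
    try lra;
    try (apply ex_RInt_everywhere_continuous; first
      [apply continuous_sub_mult|apply continuous_rsub_mult]; assumption).
  - intros y Hy; apply Rmult_le_pos; [lra|apply Hpos; lra].
  - intros y Hy; apply Rmult_le_pos; [lra|apply Hpos; lra].
Qed.

Lemma green_bounded : exists B, 0 < B /\
  forall (g : R -> R) (C : R), (forall y, continuous g y) -> 0 <= C ->
    (forall y, a <= y <= b -> Rabs (g y) <= C) ->
    forall x, a <= x <= b -> Rabs (green a b g x) <= C * B.
Proof.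
  assert (H1 : forall y : R, continuous (fun _ : R => 1) y)
    by (intros; apply continuous_const).
  destruct (exists_max_on (green a b (fun _ => 1)) a b) as (c & Hc & Hm); [lra| |].
  { intros x _; eapply is_derive_continuous, is_derive_green, H1. }
  exists (Rmax 1 (green a b (fun _ => 1) c)); split.
  { apply Rlt_le_trans with 1; [lra|apply Rmax_l]. }
  intros g C Hg HC Hbound x Hx.
  assert (Hconst : forall k, green a b (fun _ => k * 1 + 0 * 1) x
                             = k * green a b (fun _ => 1) x).
  { intros k; rewrite (green_linear (fun _ => 1) (fun _ => 1)) by assumption; ring. }
  assert (HB : C * green a b (fun _ => 1) x
               <= C * Rmax 1 (green a b (fun _ => 1) c)).
  { apply Rmult_le_compat_l; [assumption|].
    apply Rle_trans with (2 := Rmax_r _ _), Hm, Hx. }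
  apply Rabs_le_between; split.
  - apply Rle_trans with (- (C * green a b (fun _ => 1) x)); [lra|].
    replace (- (C * green a b (fun _ => 1) x))
      with ((- C) * green a b (fun _ => 1) x) by ring.
    rewrite <- Hconst; apply green_le; try assumption;
      [intros; apply continuous_const|].
    intros y Hy; specialize (Hbound y Hy); apply Rabs_le_between in Hbound; lra.
  - apply Rle_trans with (2 := HB).
    rewrite <- Hconst; apply green_le; try assumption;
      [intros; apply continuous_const|].
    intros y Hy; specialize (Hbound y Hy); apply Rabs_le_between in Hbound; lra.
Qed.

(** The difference of the two sides has zero second derivative and vanishes at
    both ends. *)
Lemma green_representation (F F1 g : R -> R) :
  (forall y, continuous g y) ->
  (forall y, a <= y <= b -> is_derive F y (F1 y) /\ is_derive F1 y (- g y)) ->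
  forall x, a <= x <= b ->
  F x = F a * ((b - x) / (b - a)) + F b * ((x - a) / (b - a)) + green a b g x.
Proof.
  intros Hg HF.
  set (D := fun y => F y - green a b g y).
  set (D1 := fun y => F1 y - green_deriv a b g y).
  assert (HD : forall y, a <= y <= b -> is_derive D y (D1 y)).
  { intros y Hy; apply (is_derive_minus F (green a b g) y); [apply HF, Hy|].
    apply is_derive_green, Hg. }
  assert (HD1 : forall y, a <= y <= b -> is_derive D1 y 0).
  { intros y Hy; evar_last.
    - apply (is_derive_minus F1 (green_deriv a b g) y); [apply HF, Hy|].
      apply is_derive_green_deriv, Hg.
    - unfold minus, plus, opp; simpl; ring. }
  assert (Hconst : forall y, a <= y <= b -> D1 a = D1 y).
  { intros y Hy; apply constant_of_derive with (f' := fun _ => 0); [lra| |].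
    - intros z Hz; split; [apply HD1; lra|reflexivity].
    - intros z Hz; eapply is_derive_continuous, HD1; lra. }
  assert (HDlin : forall y, a <= y <= b -> D y = D a + D1 a * (y - a)).
  { intros y Hy; destruct (Req_dec a y) as [<-|Hne]; [ring|].
    destruct (mean_value D D1 a y) as (c & Hc & Heq); [lra| | |].
    - intros z Hz; apply HD; lra.
    - intros z Hz; eapply is_derive_continuous, HD; lra.
    - rewrite <- (Hconst c) in Heq by lra; lra. }
  intros x Hx.
  assert (Hb := HDlin b ltac:(lra)); specialize (HDlin x Hx).
  unfold D in Hb, HDlin; rewrite green_left in Hb, HDlin; rewrite green_right in Hb.
  assert (Hs : D1 a = (F b - F a) / (b - a)).
  { apply Rmult_eq_reg_r with (b - a); [|lra].
    unfold Rdiv; rewrite Rmult_assoc, Rinv_l; lra. }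
  rewrite Hs in HDlin.
  replace (F x)
    with (F a + (F b - F a) / (b - a) * (x - a) + green a b g x) by lra.
  field; lra.
Qed.

End Green.

(** * A singular boundary value problem *)

(** Composition with [clamp] extends a continuous function on [[lo, hi]] to the
    whole line. *)
Definition clamp (lo hi x : R) : R := Rmax lo (Rmin hi x).

Lemma clamp_between (lo hi x : R) : lo <= hi -> lo <= clamp lo hi x <= hi.
Proof.
  intros H; unfold clamp; split; [apply Rmax_l|].
  apply Rmax_lub; [assumption|apply Rmin_l].
Qed.

Lemma clamp_id (lo hi x : R) : lo <= x <= hi -> clamp lo hi x = x.
Proof. intros H; unfold clamp; rewrite Rmin_right, Rmax_right; lra. Qed.

Lemma continuous_Rmax_const (c x : R) : continuous (Rmax c) x.
Proof.
  apply continuous_epsilon; intros e He; exists e; split; [assumption|].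
  intros y Hy; apply Rabs_def2 in Hy; apply Rabs_def1;
    unfold Rmax; destruct (Rle_dec c x), (Rle_dec c y); lra.
Qed.

Lemma continuous_clamp (lo hi x : R) : continuous (clamp lo hi) x.
Proof.
  apply (continuous_comp (Rmin hi) (Rmax lo)); [|apply continuous_Rmax_const].
  apply continuous_epsilon; intros e He; exists e; split; [assumption|].
  intros y Hy; apply Rabs_def2 in Hy; apply Rabs_def1;
    unfold Rmin; destruct (Rle_dec hi x), (Rle_dec hi y); lra.
Qed.

(** Weighted arithmetic-geometric mean inequality in logarithmic form. Adding
    [e] to a quantity [t <= K] reduces its relative variations by the factor
    [K / (e + K) < 1]. *)
Lemma ln_shift_contraction (e K t1 t2 d : R) :
  0 < e -> 0 <= t1 <= K -> 0 <= d -> exp (- d) * t1 <= t2 ->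
  ln (e + t1) - ln (e + t2) <= K / (e + K) * d.
Proof.
  intros He Ht Hd Ht2.
  set (w := t1 / (e + t1)).
  assert (Hw : w * (e + t1) = t1) by (unfold w; field; lra).
  assert (HwK : w <= K / (e + K)).
  { unfold w; apply Rmult_le_reg_r with ((e + t1) * (e + K)); [nra|].
    replace (t1 / (e + t1) * ((e + t1) * (e + K))) with (t1 * (e + K))
      by (field; lra).
    replace (K / (e + K) * ((e + t1) * (e + K))) with (K * (e + t1))
      by (field; lra).
    nra. }
  assert (Hexp := exp_pos (- (w * d))).
  assert (E0 : exp (- (w * d)) * (1 + w * d) <= 1).
  { replace 1 with (exp (- (w * d)) * exp (w * d)) at 2
      by (rewrite <- exp_plus, Rplus_opp_l; apply exp_0).
     apply Rmult_le_compat_l; [lra|apply exp_ineq1_le]. }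
  assert (E1 : exp (- (w * d)) * (1 + (w * d - d)) <= exp (- d)).
  { replace (- d) with (- (w * d) + (w * d - d)) by ring.
    rewrite exp_plus; apply Rmult_le_compat_l; [lra|apply exp_ineq1_le]. }
  assert (Hmain : exp (- (w * d)) * (e + t1) <= e + t2).
  { apply Rle_trans with (e * 1 + exp (- d) * t1); [|lra].
    apply Rle_trans with (e * (exp (- (w * d)) * (1 + w * d))
      + exp (- (w * d)) * (1 + (w * d - d)) * t1).
    - right.
      replace (e * (exp (- (w * d)) * (1 + w * d))
               + exp (- (w * d)) * (1 + (w * d - d)) * t1)
        with (exp (- (w * d)) * (e + t1 + (w * (e + t1) - t1) * d)) by ring.
      rewrite Hw; ring.
    - apply Rplus_le_compat.
      + apply Rmult_le_compat_l; lra.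
      + apply Rmult_le_compat_r; lra. }
  assert (Hln : - (w * d) + ln (e + t1) <= ln (e + t2)).
  { rewrite <- (ln_exp (- (w * d))) at 1.
    rewrite <- ln_mult by lra.
    apply ln_le; [apply Rmult_lt_0_compat; lra|exact Hmain]. }
  assert (w * d <= K / (e + K) * d) by (apply Rmult_le_compat_r; assumption).
  lra.
Qed.

Section BVP.

Variables (a : R -> R) (lo hi m M : R).
Hypothesis Hlh : lo < hi.
Hypothesis Hm : 0 < m.
Hypothesis Ha : forall x, m <= a x <= M.
Hypothesis Hac : forall x, continuous a x.

Definition lifted_solution (e : R) (F F1 : R -> R) : Prop :=
  F lo = e /\ F hi = e /\
  forall x, lo <= x <= hi ->
    e <= F x /\ is_derive F x (F1 x) /\ is_derive F1 x (- (a x / (2 * F x))).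

(** In the unknown [ln F] the problem is a fixed point problem for a
    contraction, because [F] enters the right-hand side with exponent [-1] and
    the boundary value [e] is added to the integral. *)
Lemma lifted_solution_exists (e : R) :
  0 < e -> exists F F1, lifted_solution e F F1.
Proof.
  intros He.
  destruct (green_bounded lo hi Hlh) as (B & HB & Hbound).
  set (g := fun (u : R -> R) s => a s * (exp (- u s) / 2)).
  set (T := fun u x => ln (e + green lo hi (g u) (clamp lo hi x))).
  set (P := fun u : R -> R => (forall x, continuous u x) /\ forall x, ln e <= u x).
  set (K := M / (2 * e) * B).
  assert (HM : 0 < M) by (specialize (Ha 0); lra).
  assert (HK : 0 < K).
  { apply Rmult_lt_0_compat; [apply Rdiv_lt_0_compat|]; lra. }
  assert (Hcl : forall x, lo <= clamp lo hi x <= hi)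
    by (intros; apply clamp_between; lra).
  assert (Hgc : forall u, P u -> forall x, continuous (g u) x).
  { intros u [Hu _] x; apply (continuous_mult a (fun s => exp (- u s) / 2));
      [apply Hac|].
    apply (continuous_mult (fun s => exp (- u s)) (fun _ => / 2));
      [|apply continuous_const].
    apply (continuous_comp (fun s => - u s) exp).
    - apply (continuous_opp u), Hu.
    - apply continuity_pt_filterlim, derivable_continuous_pt, derivable_pt_exp. }
  assert (Hgpos : forall u x, 0 < g u x).
  { intros u x; apply Rmult_lt_0_compat; [specialize (Ha x); lra|].
    assert (H := exp_pos (- u x)); lra. }
  assert (Hgle : forall u, P u -> forall x, Rabs (g u x) <= M / (2 * e)).
  { intros u [_ Hu] x; rewrite Rabs_pos_eq by (left; apply Hgpos).
    replace (M / (2 * e)) with (M * (exp (- ln e) / 2)).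
    - unfold g; apply Rmult_le_compat; [specialize (Ha x); lra| |apply Ha|].
      + assert (H := exp_pos (- u x)); lra.
      + apply Rmult_le_compat_r; [lra|].
        destruct (Req_dec (u x) (ln e)) as [->|Hne]; [lra|].
        left; apply exp_increasing; specialize (Hu x); lra.
    - rewrite exp_Ropp, exp_ln by lra; field; lra. }
  assert (Hgreen : forall u, P u -> forall x, lo <= x <= hi ->
            0 <= green lo hi (g u) x <= K).
  { intros u Hu x Hx; split.
    - apply green_nonneg; [exact Hlh|apply Hgc, Hu| |exact Hx].
      intros; left; apply Hgpos.
    - apply Rle_trans with (1 := Rle_abs _), Hbound;
        [apply Hgc, Hu| |intros; apply Hgle, Hu|exact Hx].
      left; apply Rdiv_lt_0_compat; lra. }
  assert (Hhalf : forall u v d, P u -> P v ->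
    (forall x, Rabs (u x - v x) <= d) ->
    forall x, T u x - T v x <= K / (e + K) * d).
  { intros u v d Hu Hv Hd x; unfold T.
    apply ln_shift_contraction; [exact He|apply Hgreen; auto| |].
    - specialize (Hd 0); assert (H := Rabs_pos (u 0 - v 0)); lra.
    - replace (exp (- d) * green lo hi (g u) (clamp lo hi x))
        with (green lo hi (fun s => exp (- d) * g u s + 0 * g u s)
                (clamp lo hi x))
        by (rewrite green_linear by (try apply Hgc; assumption); ring).
      apply green_le; [exact Hlh| |apply Hgc, Hv| |apply Hcl].
      + intros y; apply (continuous_plus (fun s => exp (- d) * g u s)
                           (fun s => 0 * g u s));
          apply (continuous_mult (fun _ : R => _) (g u));
          try apply continuous_const; apply Hgc, Hu.
      + intros y _; rewrite Rmult_0_l, Rplus_0_r; unfold g.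
        rewrite <- Rmult_assoc, (Rmult_comm (exp (- d))), Rmult_assoc.
        apply Rmult_le_compat_l; [specialize (Ha y); lra|].
        unfold Rdiv; rewrite <- Rmult_assoc, <- exp_plus.
        apply Rmult_le_compat_r; [lra|].
        specialize (Hd y); apply Rabs_le_between in Hd.
        destruct (Req_dec (- d + - u y) (- v y)) as [->|Hne]; [lra|].
        left; apply exp_increasing; lra. }
  assert (HTlow : forall u, P u -> forall x, ln e <= T u x <= ln (e + K)).
  { intros u Hu x; assert (H := Hgreen u Hu _ (Hcl x)).
    split; apply ln_le; lra. }
  destruct (contraction_fixed_point P T (K / (e + K)) (ln (e + K) - ln e)
              (fun _ => ln e)) as (u & Hu & Hfix).
  - split; [left; apply Rdiv_lt_0_compat; lra|].
    apply Rmult_lt_reg_r with (e + K); [lra|].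
    unfold Rdiv; rewrite Rmult_assoc, Rinv_l; lra.
  - split; [intros; apply continuous_const|intros; lra].
  - intros u Hu; split; [|intros x; apply HTlow, Hu]; intros x.
    unfold T; apply (continuous_comp
      (fun x => e + green lo hi (g u) (clamp lo hi x)) ln).
    + apply (continuous_plus (fun _ => e)
               (fun x => green lo hi (g u) (clamp lo hi x)));
        [apply continuous_const|].
      apply (continuous_comp (clamp lo hi) (green lo hi (g u)));
        [apply continuous_clamp|].
      eapply is_derive_continuous, is_derive_green; [exact Hlh|apply Hgc, Hu].
    + assert (H := Hgreen u Hu _ (Hcl x)).
      apply continuity_pt_filterlim, derivable_continuous_pt.
      exists (/ (e + green lo hi (g u) (clamp lo hi x))).
      apply derivable_pt_lim_ln; lra.
  - intros u v d Hu Hv Hd x.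
    assert (H1 := Hhalf u v d Hu Hv Hd x).
    assert (H2 := Hhalf v u d Hv Hu
      ltac:(intros y; rewrite Rabs_minus_sym; apply Hd) x).
    apply Rabs_le_between; lra.
  - intros x; assert (H := HTlow (fun _ => ln e)
      (conj (fun x => continuous_const (ln e) x) (fun _ => Rle_refl (ln e))) x).
    rewrite Rabs_pos_eq; lra.
  - intros u f r Hu Hr Hf; split.
    + apply (continuous_uniform_limit u f r); [intros n; apply Hu|exact Hr|exact Hf].
    + intros x.
      apply (is_lim_seq_le (fun _ => ln e) (fun n => u n x) (ln e) (f x)).
      * intros n; apply Hu.
      * apply is_lim_seq_const.
      * apply (lim_of_error _ r _ 1 Hr); intros n; rewrite Rmult_1_l; apply Hf.
  - exists (fun x => e + green lo hi (g u) x), (green_deriv lo hi (g u)).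
    split; [rewrite green_left by exact Hlh; ring|].
    split; [rewrite green_right by exact Hlh; ring|].
    intros x Hx; assert (H := Hgreen u Hu x Hx).
    assert (Hux : u x = ln (e + green lo hi (g u) x)).
    { rewrite <- Hfix; unfold T; rewrite clamp_id by exact Hx; reflexivity. }
    split; [lra|split].
    + evar_last.
      * apply (is_derive_plus (fun _ => e) (green lo hi (g u)) x 0);
          [apply (is_derive_const e)|].
        apply is_derive_green; [exact Hlh|apply Hgc, Hu].
      * unfold plus; simpl; ring.
    + evar_last.
      * apply is_derive_green_deriv; [exact Hlh|apply Hgc, Hu].
      * unfold g at 1; rewrite Hux, exp_Ropp, exp_ln by lra; field; lra.
Qed.

(** Where [F - G] exceeds [|e1 - e2|], in particular [F > G], so that
    [(F - G)'' = a / (2 G) - a / (2 F) > 0]. *)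
Lemma lifted_solution_diff_le (e1 e2 : R) (F F1 G G1 : R -> R) :
  0 < e1 -> 0 < e2 -> lifted_solution e1 F F1 -> lifted_solution e2 G G1 ->
  forall x, lo <= x <= hi -> F x - G x <= Rabs (e1 - e2).
Proof.
  intros He1 He2 (HFl & HFh & HF) (HGl & HGh & HG).
  apply (maximum_principle (fun x => F x - G x) (fun x => F1 x - G1 x)
           (fun x => - (a x / (2 * F x)) - - (a x / (2 * G x))));
    [exact Hlh| | | | | |].
  - intros x Hx; apply (continuous_minus F G);
      eapply is_derive_continuous;
        [exact (proj1 (proj2 (HF x Hx)))|exact (proj1 (proj2 (HG x Hx)))].
  - intros x Hx; destruct (HF x ltac:(lra)) as (_ & HF1 & _).
    destruct (HG x ltac:(lra)) as (_ & HG1 & _).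
    exact (is_derive_minus F G x _ _ HF1 HG1).
  - intros x Hx; destruct (HF x ltac:(lra)) as (_ & _ & HF2).
    destruct (HG x ltac:(lra)) as (_ & _ & HG2).
    exact (is_derive_minus F1 G1 x _ _ HF2 HG2).
  - intros x Hx Hgt.
    assert (H0 := Rabs_pos (e1 - e2)).
    destruct (HG x ltac:(lra)) as (HGx & _).
    assert (Hax := Ha x).
    assert (/ (2 * F x) < / (2 * G x)) by (apply Rinv_lt_contravar; nra).
    assert (a x * / (2 * F x) < a x * / (2 * G x))
      by (apply Rmult_lt_compat_l; lra).
    unfold Rdiv; lra.
  - rewrite HFl, HGl; apply Rle_abs.
  - rewrite HFh, HGh; apply Rle_abs.
Qed.

Lemma lifted_solution_dist (e1 e2 : R) (F F1 G G1 : R -> R) :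
  0 < e1 -> 0 < e2 -> lifted_solution e1 F F1 -> lifted_solution e2 G G1 ->
  forall x, lo <= x <= hi -> Rabs (F x - G x) <= Rabs (e1 - e2).
Proof.
  intros He1 He2 HF HG x Hx.
  assert (H1 := lifted_solution_diff_le e1 e2 F F1 G G1 He1 He2 HF HG x Hx).
  assert (H2 := lifted_solution_diff_le e2 e1 G G1 F F1 He2 He1 HG HF x Hx).
  rewrite Rabs_minus_sym in H2; apply Rabs_le_between; lra.
Qed.

Definition barrier (x : R) : R :=
  sqrt m / (4 * (hi - lo)) * ((x - lo) * (hi - x)).

Lemma barrier_pos (x : R) : lo < x < hi -> 0 < barrier x.
Proof.
  intros Hx; apply Rmult_lt_0_compat.
  - apply Rdiv_lt_0_compat; [apply sqrt_lt_R0; assumption|lra].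
  - apply Rmult_lt_0_compat; lra.
Qed.

(** The barrier does not depend on [e]: it keeps the limit for [e] tending to [0]
    positive in the open interval. *)
Lemma lifted_solution_ge_barrier (e : R) (F F1 : R -> R) :
  0 < e -> lifted_solution e F F1 ->
  forall x, lo <= x <= hi -> barrier x <= F x.
Proof.
  intros He (HFl & HFh & HF) x Hx.
  set (k := sqrt m / (4 * (hi - lo))).
  set (h := hi - lo).
  assert (Hsq := sqrt_lt_R0 m Hm).
  assert (Hk : 0 < k) by (apply Rdiv_lt_0_compat; lra).
  (* [k] is chosen so that [a / (2 F)] exceeds [2 k] wherever [F] is below the
     barrier. *)
  assert (Hkh : k * h * (k * h) * 16 = m).
  { rewrite <- (sqrt_sqrt m) by lra; unfold k, h; field; lra. }
  cut (barrier x - F x <= 0); [lra|].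
  revert x Hx.
  apply (maximum_principle (fun x => barrier x - F x)
           (fun x => k * (hi + lo - 2 * x) - F1 x)
           (fun x => - (2 * k) - - (a x / (2 * F x))));
    [exact Hlh| | | | | |].
  - intros x Hx; apply (continuous_minus barrier F).
    + apply (ex_derive_continuous barrier); unfold barrier; auto_derive; auto.
    + eapply is_derive_continuous; exact (proj1 (proj2 (HF x Hx))).
  - intros x Hx; destruct (HF x ltac:(lra)) as (_ & HF1 & _).
    apply (is_derive_minus barrier F); [|exact HF1].
    unfold barrier; fold k; auto_derive; [auto|ring].
  - intros x Hx; destruct (HF x ltac:(lra)) as (_ & _ & HF2).
    apply (is_derive_minus (fun x => k * (hi + lo - 2 * x)) F1); [|exact HF2].
    auto_derive; [auto|ring].
  - intros x Hx Hgt.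
    destruct (HF x ltac:(lra)) as (HFe & _); assert (HFx : 0 < F x) by lra.
    assert (HFs : F x < k * (h * h)).
    { apply Rlt_le_trans with (barrier x); [lra|].
      apply Rmult_le_compat_l; [fold k; lra|].
      apply Rmult_le_compat; unfold h; lra. }
    assert (Hax := Ha x).
    assert (2 * k < a x / (2 * F x)).
    { apply Rmult_lt_reg_r with (2 * F x); [lra|].
      replace (a x / (2 * F x) * (2 * F x)) with (a x) by (field; lra).
      assert (k * F x < k * (k * (h * h))) by (apply Rmult_lt_compat_l; assumption).
      nra. }
    lra.
  - unfold barrier; replace (lo - lo) with 0 by ring; rewrite HFl; nra.
  - unfold barrier; replace (hi - hi) with 0 by ring; rewrite HFh; nra.
Qed.

End BVP.

Definition singular_solution (a : R -> R) (lo hi : R) (Q : R -> R) : Prop :=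
  (forall x, continuous Q x) /\ Q lo = 0 /\ Q hi = 0 /\
  forall x, lo < x < hi ->
    0 < Q x /\ is_derive Q x (Derive Q x) /\
    is_derive (Derive Q) x (- (a x / (2 * Q x))).

Lemma lipschitz_inv_max (q u v : R) :
  0 < q ->
  Rabs (/ (2 * Rmax q u) - / (2 * Rmax q v)) <= / (2 * (q * q)) * Rabs (u - v).
Proof.
  intros Hq.
  assert (Hu := Rmax_l q u); assert (Hv := Rmax_l q v).
  assert (Huv : Rabs (Rmax q v - Rmax q u) <= Rabs (u - v)).
  { unfold Rmax; destruct (Rle_dec q u), (Rle_dec q v);
      unfold Rabs; repeat destruct (Rcase_abs _); lra. }
  replace (/ (2 * Rmax q u) - / (2 * Rmax q v))
    with (/ (2 * (Rmax q u * Rmax q v)) * (Rmax q v - Rmax q u))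
    by (field; lra).
  assert (Hpos : 0 < / (2 * (Rmax q u * Rmax q v)))
    by (apply Rinv_0_lt_compat; nra).
  rewrite Rabs_mult, (Rabs_pos_eq (/ _)) by lra.
  apply Rmult_le_compat; [lra|apply Rabs_pos| |exact Huv].
  apply Rinv_le_contravar; nra.
Qed.

Section Existence.

Variables (a : R -> R) (lo hi m M : R).
Hypothesis Hlh : lo < hi.
Hypothesis Hm : 0 < m.
Hypothesis Ha : forall x, m <= a x <= M.
Hypothesis Hac : forall x, continuous a x.

(** The solutions lifted by [e = 2^-n] converge uniformly. On a compact
    subinterval each of them is its linear interpolant plus the Green operator
    applied to [a / (2 F)]; this identity contains no derivative of [F], so it
    passes to the uniform limit and shows that the limit is twice
    differentiable. *)
Lemma singular_solution_exists : exists Q, singular_solution a lo hi Q.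
Proof.
  set (e := fun n => (/ 2) ^ n).
  assert (He : forall n, 0 < e n) by (intros; apply pow_lt; lra).
  assert (He0 : is_lim_seq e 0)
    by (apply is_lim_seq_geom; rewrite Rabs_pos_eq; lra).
  assert (Hedec : forall n k, (n <= k)%nat -> e k <= e n).
  { intros n k Hnk; induction Hnk; [lra|].
    specialize (He m0); unfold e in *; simpl; lra. }
  assert (Hchoice : exists FF : nat -> (R -> R) * (R -> R),
            forall n, lifted_solution a lo hi (e n) (fst (FF n)) (snd (FF n))).
  { assert (Hex : forall n, exists FF : (R -> R) * (R -> R),
      lifted_solution a lo hi (e n) (fst FF) (snd FF)).
    { intros n.
      destruct (lifted_solution_exists a lo hi m M Hlh Hm Ha Hac (e n) (He n))
        as (F & F1 & HF).
      exists (F, F1); exact HF. }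
    exists (fun n => proj1_sig (constructive_indefinite_description _ (Hex n))).
    intros n; exact (proj2_sig (constructive_indefinite_description _ (Hex n))). }
  destruct Hchoice as (FF & HFF).
  set (F := fun n => fst (FF n)); set (F1 := fun n => snd (FF n)).
  assert (HF : forall n, lifted_solution a lo hi (e n) (F n) (F1 n)) by exact HFF.
  clearbody F F1; clear FF HFF.
  set (u := fun n x => F n (clamp lo hi x)).
  assert (Hcl : forall x, lo <= clamp lo hi x <= hi)
    by (intros; apply clamp_between; lra).
  assert (Huc : forall n x, continuous (u n) x).
  { intros n x; apply (continuous_comp (clamp lo hi) (F n));
      [apply continuous_clamp|].
    destruct (HF n) as (_ & _ & HFn).
    eapply is_derive_continuous; exact (proj1 (proj2 (HFn _ (Hcl x)))). }
  destruct (uniform_cauchy_limit u e He0) as (Q & HQ).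
  { intros n k x Hnk; unfold u.
    apply Rle_trans with (Rabs (e k - e n)).
    - apply (lifted_solution_dist a lo hi m M Hlh Hm Ha _ _ _ (F1 k) _ (F1 n));
        auto.
    - specialize (Hedec n k Hnk); assert (H := He k).
      apply Rabs_le_between; lra. }
  assert (HQF : forall n x, lo <= x <= hi -> Rabs (F n x - Q x) <= e n).
  { intros n x Hx; rewrite <- (clamp_id lo hi x Hx) at 1; apply HQ. }
  assert (HQlim : forall x, lo <= x <= hi -> is_lim_seq (fun n => F n x) (Q x)).
  { intros x Hx; apply (lim_of_error _ e _ 1 He0).
    intros n; rewrite Rmult_1_l; apply HQF, Hx. }
  assert (HQc : forall x, continuous Q x)
    by (exact (continuous_uniform_limit u Q e Huc He0 HQ)).
  assert (Hbar : forall x, lo <= x <= hi -> barrier lo hi m x <= Q x).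
  { intros x Hx; apply (le_of_lim_error (fun n => F n x) e); [exact He0| |].
    - intros n; apply HQF, Hx.
    - intros n; apply (lifted_solution_ge_barrier a lo hi m M Hlh Hm Ha (e n) _
                         (F1 n)); auto. }
  exists Q; split; [exact HQc|].
  assert (Hend : forall x, lo <= x <= hi -> (forall n, F n x = e n) -> Q x = 0).
  { intros x Hx Hn.
    assert (H := is_lim_seq_unique _ _ (HQlim x Hx)).
    rewrite (Lim_seq_ext _ _ Hn), (is_lim_seq_unique _ _ He0) in H.
    injection H; auto. }
  split; [apply Hend; [lra|intros n; exact (proj1 (HF n))]|].
  split; [apply Hend; [lra|intros n; exact (proj1 (proj2 (HF n)))]|].
  intros x Hx.
  set (p := (lo + x) / 2); set (r := (x + hi) / 2).
  assert (Hpr : lo < p < x /\ x < r < hi) by (unfold p, r; lra).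
  clearbody p r.
  destruct (exists_min_on (barrier lo hi m) p r) as (c & Hc & Hmin); [lra| |].
  { intros y _; apply (ex_derive_continuous (barrier lo hi m)).
    unfold barrier; auto_derive; auto. }
  set (q := barrier lo hi m c).
  assert (Hq : 0 < q) by (apply barrier_pos; lra).
  (* Truncation at the level [q] makes the right-hand side continuous on the
     whole line and does not change it on [[p, r]]. *)
  set (g := fun w s => a s * / (2 * Rmax q (w s))).
  assert (Hgc : forall w, (forall s, continuous w s) -> forall s, continuous (g w) s).
  { intros w Hw s; apply (continuous_mult a (fun s => / (2 * Rmax q (w s))));
      [apply Hac|].
    apply (continuous_comp (fun s => 2 * Rmax q (w s)) Rinv).
    - apply (continuous_mult (fun _ => 2) (fun s => Rmax q (w s)));
        [apply continuous_const|].
      apply (continuous_comp w (Rmax q)); [apply Hw|apply continuous_Rmax_const].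
    - apply continuous_Rinv; assert (H := Rmax_l q (w s)); lra. }
  assert (Hgq : forall w s, q <= w s -> g w s = a s / (2 * w s)).
  { intros w s Hw; unfold g; rewrite Rmax_right by exact Hw; reflexivity. }
  assert (Hp_r : p < r) by lra.
  set (lin := fun (w : R -> R) y =>
                w p * ((r - y) / (r - p)) + w r * ((y - p) / (r - p))).
  assert (Hrep : forall n y, p <= y <= r ->
            F n y = lin (F n) y + green p r (g (u n)) y).
  { intros n; apply (green_representation p r Hp_r (F n) (F1 n));
      [apply Hgc, Huc|].
    intros y Hy.
    assert (Hu : u n y = F n y) by (unfold u; rewrite clamp_id; [reflexivity|lra]).
    destruct (HF n) as (_ & _ & HFn).
    rewrite Hgq, Hu; [exact (proj2 (HFn y ltac:(lra)))|rewrite Hu].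
    apply Rle_trans with (barrier lo hi m y); [apply Hmin, Hy|].
    apply (lifted_solution_ge_barrier a lo hi m M Hlh Hm Ha (e n) _ (F1 n));
      auto; lra. }
  assert (HQrep : forall y, p <= y <= r -> Q y = lin Q y + green p r (g Q) y).
  { intros y Hy.
    destruct (green_bounded p r Hp_r) as (B & HB & Hbound).
    assert (Hlim : is_lim_seq (fun n => F n y) (lin Q y + green p r (g Q) y)).
    { apply (is_lim_seq_ext (fun n => lin (F n) y + green p r (g (u n)) y)).
      { intros n; symmetry; apply Hrep, Hy. }
      apply is_lim_seq_plus'.
      - apply is_lim_seq_plus';
          apply (is_lim_seq_scal_r _ _ (Finite _)), HQlim; lra.
      - apply (lim_of_error _ e _ (M * / (2 * (q * q)) * B) He0); intros n.
        assert (Hdiff : green p r (g (u n)) y - green p r (g Q) y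
          = green p r (fun s => 1 * g (u n) s + (- 1) * g Q s) y).
        { rewrite green_linear; [ring|exact Hp_r|apply Hgc, Huc|apply Hgc, HQc]. }
        rewrite Hdiff, Rmult_assoc, (Rmult_comm B), <- Rmult_assoc.
        apply Hbound; [| | |exact Hy].
        + intros s; apply (continuous_plus (fun s => 1 * g (u n) s)
                             (fun s => (- 1) * g Q s)).
          * apply (continuous_mult (fun _ => 1) (g (u n)));
              [apply continuous_const|apply Hgc, Huc].
          * apply (continuous_mult (fun _ => - 1) (g Q));
              [apply continuous_const|apply Hgc, HQc].
        + assert (0 < / (2 * (q * q))) by (apply Rinv_0_lt_compat; nra).
          specialize (Ha 0); specialize (He n).
          apply Rmult_le_pos; [apply Rmult_le_pos; lra|lra].
        + intros s _.
          replace (1 * g (u n) s + - 1 * g Q s)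
            with (a s * (/ (2 * Rmax q (u n s)) - / (2 * Rmax q (Q s))))
            by (unfold g; ring).
          assert (Has := Ha s).
          rewrite Rabs_mult, Rabs_pos_eq, Rmult_assoc by lra.
          apply Rmult_le_compat; [lra|apply Rabs_pos|lra|].
          apply Rle_trans with (1 := lipschitz_inv_max q (u n s) (Q s) Hq).
          apply Rmult_le_compat_l; [|apply HQ].
          left; apply Rinv_0_lt_compat; nra. }
    apply is_lim_seq_unique in Hlim.
    rewrite (is_lim_seq_unique _ _ (HQlim y ltac:(lra))) in Hlim.
    injection Hlim; auto. }
  assert (HQ1 : forall y, p < y < r -> is_derive Q y
            ((Q r - Q p) / (r - p) + green_deriv p r (g Q) y)).
  { intros y Hy.
    apply (is_derive_ext_loc (fun y => lin Q y + green p r (g Q) y)).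
    - apply (filter_imp (fun z => p < z < r)); [|apply locally_between, Hy].
      intros z Hz; symmetry; apply HQrep; lra.
    - apply (is_derive_plus (lin Q) (green p r (g Q))).
      + unfold lin; auto_derive; [auto|field; lra].
      + apply is_derive_green; [exact Hp_r|apply Hgc, HQc]. }
  split; [apply Rlt_le_trans with (2 := Hbar x ltac:(lra)), barrier_pos; lra|].
  split.
  - apply Derive_correct; eexists; apply HQ1; lra.
  - apply (is_derive_ext_loc
      (fun y => (Q r - Q p) / (r - p) + green_deriv p r (g Q) y)).
    + apply (filter_imp (fun z => p < z < r)); [|apply locally_between; lra].
      intros z Hz; symmetry; apply is_derive_unique, HQ1, Hz.
    + evar_last.
      * apply (is_derive_plus (fun _ => (Q r - Q p) / (r - p))
                 (green_deriv p r (g Q)) x 0).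
        -- apply (is_derive_const ((Q r - Q p) / (r - p))).
        -- apply is_derive_green_deriv; [exact Hp_r|apply Hgc, HQc].
      * rewrite Hgq; [unfold plus; simpl; ring|].
        apply Rle_trans with (2 := Hbar x ltac:(lra)), Hmin; lra.
Qed.

End Existence.

(** * Slopes of singular solutions *)

(** Near the zero [lo] a bound [Q' <= K] would give [Q <= K (x - lo)], hence
    [Q'' <= - m / (2 K (x - lo))], whose integral diverges logarithmically. *)
Lemma singular_solution_slope_unbounded (a Q : R -> R) (lo hi m : R) :
  lo < hi -> 0 < m -> (forall x, lo < x < hi -> m <= a x) ->
  singular_solution a lo hi Q ->
  forall K, exists x, lo < x < hi /\ K < Derive Q x.
Proof.
  intros Hlh Hm Ha (HQc & HQl & _ & HQ) K0.
  apply NNPP; intros Hno.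
  set (K := Rmax 1 K0).
  assert (HK : 0 < K) by (apply Rlt_le_trans with (2 := Rmax_l 1 K0); lra).
  assert (Hle : forall x, lo < x < hi -> Derive Q x <= K).
  { intros x Hx; apply Rle_trans with (2 := Rmax_r 1 K0).
    apply Rnot_lt_le; intros H; apply Hno; exists x; split; assumption. }
  assert (HQle : forall x, lo < x < hi -> Q x <= K * (x - lo)).
  { intros x Hx.
    destruct (mean_value Q (Derive Q) lo x) as (c & Hc & Heq); [lra| | |].
    - intros y Hy; exact (proj1 (proj2 (HQ y ltac:(lra)))).
    - intros; apply HQc.
    - rewrite HQl in Heq.
      assert (Derive Q c * (x - lo) <= K * (x - lo))
        by (apply Rmult_le_compat_r; [lra|apply Hle; lra]).
      lra. }
  set (c := (lo + hi) / 2).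
  set (k := m / (2 * K)).
  assert (Hk : 0 < k) by (apply Rdiv_lt_0_compat; lra).
  set (f := fun x => - Derive Q x - k * ln (x - lo)).
  assert (Hmono : forall x, lo < x < c -> f x <= f c).
  { intros x Hx.
    assert (Hf : forall y, lo < y < hi ->
              is_derive f y (a y / (2 * Q y) - k / (y - lo))).
    { intros y Hy.
      destruct (HQ y Hy) as (HQy & _ & H2).
      unfold f; auto_derive.
      - split; [eexists; exact H2|split; [lra|auto]].
      - replace (Derive (fun z => Derive Q z) y)
          with (- (a y / (2 * Q y)))
          by (symmetry; exact (is_derive_unique _ _ _ H2)).
        field; lra. }
    apply nondecreasing_of_derive
      with (f' := fun y => a y / (2 * Q y) - k / (y - lo)).
    - lra.
    - intros y Hy; split; [apply Hf; unfold c in *; lra|].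
      assert (Hyy : lo < y < hi) by (unfold c in *; lra).
      assert (HQy := proj1 (HQ y Hyy)); specialize (HQle y Hyy).
      specialize (Ha y Hyy).
      assert (k / (y - lo) <= a y / (2 * Q y)); [|lra].
      apply Rle_trans with (m / (2 * (K * (y - lo)))).
      + right; unfold k; field; lra.
      + unfold Rdiv; apply Rmult_le_compat; [lra| |exact Ha|].
        * left; apply Rinv_0_lt_compat; nra.
        * apply Rinv_le_contravar; lra.
    - intros y Hy; eapply is_derive_continuous, Hf; unfold c in *; lra. }
  (* a point so close to [lo] that [f] exceeds [f c] there *)
  set (z := Rmin ((c - lo) / 2) (exp (- (K + f c + 1) / k))).
  assert (Hz : 0 < z).
  { apply Rmin_pos; [unfold c; lra|apply exp_pos]. }
  assert (Hzc : z < c - lo).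
  { apply Rle_lt_trans with (1 := Rmin_l _ _); unfold c; lra. }
  assert (Hln : ln z <= - (K + f c + 1) / k).
  { rewrite <- (ln_exp (- (K + f c + 1) / k)).
    apply ln_le; [exact Hz|apply Rmin_r]. }
  specialize (Hmono (lo + z) ltac:(lra)); unfold f at 1 in Hmono.
  replace (lo + z - lo) with z in Hmono by ring.
  specialize (Hle (lo + z) ltac:(unfold c in *; lra)).
  assert (k * ln z <= k * (- (K + f c + 1) / k))
    by (apply Rmult_le_compat_l; lra).
  replace (k * (- (K + f c + 1) / k)) with (- (K + f c + 1)) in H
    by (field; lra).
  lra.
Qed.

Lemma singular_solution_reflect (a Q : R -> R) (lo hi : R) :
  singular_solution a lo hi Q ->
  singular_solution (fun x => a (lo + hi - x)) lo hi (fun x => Q (lo + hi - x)) /\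
  forall x, lo < x < hi ->
    Derive (fun y => Q (lo + hi - y)) x = - Derive Q (lo + hi - x).
Proof.
  intros (HQc & HQl & HQh & HQ).
  set (s := lo + hi).
  assert (HD : forall x, lo < x < hi ->
    is_derive (fun y => Q (s - y)) x (- Derive Q (s - x))).
  { intros x Hx; apply is_derive_reflect.
    exact (proj1 (proj2 (HQ (s - x) ltac:(unfold s; lra)))). }
  assert (HDu : forall x, lo < x < hi ->
    Derive (fun y => Q (s - y)) x = - Derive Q (s - x))
    by (intros; apply is_derive_unique, HD; assumption).
  split; [|exact HDu].
  split; [|split; [|split]].
  - intros x; apply (continuous_comp (fun y => s - y) Q); [|apply HQc].
    apply (continuous_minus (fun _ : R => s) (fun y => y));
      [apply continuous_const|apply continuous_id].
  - unfold s; replace (lo + hi - lo) with hi by ring; exact HQh.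
  - unfold s; replace (lo + hi - hi) with lo by ring; exact HQl.
  - intros x Hx; destruct (HQ (s - x)) as (H0 & H1 & H2); [unfold s; lra|].
    split; [exact H0|split].
    + rewrite HDu by exact Hx; apply HD, Hx.
    + apply (is_derive_ext_loc (fun y => - Derive Q (s - y))).
      * apply (filter_imp (fun z => lo < z < hi)); [|apply locally_between, Hx].
        intros z Hz; symmetry; apply HDu, Hz.
      * evar_last.
        -- apply (is_derive_opp (fun y => Derive Q (s - y))).
           apply is_derive_reflect, H2.
        -- unfold opp; simpl; ring.
Qed.

Lemma singular_solution_ext (a b Q : R -> R) (lo hi : R) :
  (forall x, lo < x < hi -> a x = b x) ->
  singular_solution a lo hi Q -> singular_solution b lo hi Q.
Proof.
  intros Hab (HQc & HQl & HQh & HQ).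
  split; [exact HQc|split; [exact HQl|split; [exact HQh|]]].
  intros x Hx; rewrite <- Hab by exact Hx; apply HQ, Hx.
Qed.

Lemma singular_solution_slope_decreasing (a Q : R -> R) (lo hi : R) :
  (forall x, lo < x < hi -> 0 < a x) -> singular_solution a lo hi Q ->
  forall x y, lo < x -> x < y -> y < hi -> Derive Q y < Derive Q x.
Proof.
  intros Ha (_ & _ & _ & HQ) x y Hx Hxy Hy.
  cut (- Derive Q x < - Derive Q y); [lra|].
  apply (increasing_of_derive (fun z => - Derive Q z)
           (fun z => - - (a z / (2 * Q z)))); [exact Hxy| |].
  - intros z Hz; destruct (HQ z) as (H0 & _ & H2); [lra|]; split.
    + apply (is_derive_opp (Derive Q)), H2.
    + specialize (Ha z ltac:(lra)); rewrite Ropp_involutive.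
      apply Rdiv_lt_0_compat; lra.
  - intros z Hz; apply (continuous_opp (Derive Q)).
    eapply is_derive_continuous; exact (proj2 (proj2 (HQ z ltac:(lra)))).
Qed.

Lemma singular_solution_slope_onto (a Q : R -> R) (lo hi m : R) :
  lo < hi -> 0 < m -> (forall x, lo < x < hi -> m <= a x) ->
  singular_solution a lo hi Q ->
  forall s, exists x, lo < x < hi /\ Derive Q x = s.
Proof.
  intros Hlh Hm Ha HQ s.
  destruct (singular_solution_slope_unbounded a Q lo hi m Hlh Hm Ha HQ s)
    as (x & Hx & Hxs).
  destruct (singular_solution_reflect a Q lo hi HQ) as (HQr & HDr).
  assert (Har : forall z, lo < z < hi -> m <= a (lo + hi - z))
    by (intros z Hz; apply Ha; lra).
  destruct (singular_solution_slope_unbounded _ _ lo hi m Hlh Hm Har HQr (- s))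
    as (y & Hy & Hys).
  rewrite HDr in Hys by exact Hy.
  set (z := lo + hi - y) in *.
  assert (Hz : lo < z < hi) by (unfold z; lra).
  assert (Hxz : x < z).
  { destruct (Rtotal_order x z) as [H|[H|H]]; [exact H|rewrite <- H in Hys; lra|].
    apply (singular_solution_slope_decreasing a Q lo hi) in H; try lra; try exact HQ.
    intros w Hw; specialize (Ha w Hw); lra. }
  destruct (IVT_interv (fun w => s - Derive Q w) x z) as (w & Hw & Heq);
    try lra.
  - intros w Hw; apply continuous_continuity_pt.
    apply (continuous_minus (fun _ => s) (Derive Q)); [apply continuous_const|].
    destruct HQ as (_ & _ & _ & HQ).
    eapply is_derive_continuous; exact (proj2 (proj2 (HQ w ltac:(lra)))).
  - exists w; split; lra.
Qed.

(** * Scalar profiles *)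

(** The pair [(V, W)] reduced to [V], with [p = V'] and [W] eliminated through
    the energy identity. *)
Record scalar_profile (eta : R -> R) (Vm Vp E0 : R) (V p : R -> R) : Prop := {
  scalar_nonneg : forall y, 0 <= E0 - / 2 * V y ^ 2;
  scalar_derive : forall y, is_derive V y (p y);
  scalar_continuous : forall y, continuous p y;
  scalar_flux : forall y,
    is_derive (fun z => eta (E0 - / 2 * V z ^ 2) * p z) y (- (y / 2) * p y);
  scalar_minus : is_lim V m_infty Vm;
  scalar_plus : is_lim V p_infty Vp
}.

Lemma scalar_profile_opp eta Vm Vp E0 V p :
  scalar_profile eta Vm Vp E0 V p ->
  scalar_profile eta (- Vm) (- Vp) E0 (fun y => - V y) (fun y => - p y).
Proof.
  intros [Hnn Hd Hc Hf Hm Hp]; split.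
  - intros y; replace ((- V y) ^ 2) with (V y ^ 2) by ring; apply Hnn.
  - intros y; apply (is_derive_opp V), Hd.
  - intros y; apply (continuous_opp p), Hc.
  - intros y.
    apply (is_derive_ext (fun z => - (eta (E0 - / 2 * V z ^ 2) * p z))).
    + intros z; replace ((- V z) ^ 2) with (V z ^ 2) by ring.
      apply Ropp_mult_distr_r.
    + evar_last; [apply (is_derive_opp (fun z => eta (E0 - / 2 * V z ^ 2) * p z)),
                    Hf|].
      unfold opp; simpl; ring.
  - apply (is_lim_opp V m_infty Vm), Hm.
  - apply (is_lim_opp V p_infty Vp), Hp.
Qed.

(** Point reflection of the graph exchanges the two ends of the line and keeps
    [p] positive. *)
Lemma scalar_profile_rotate eta Vm Vp E0 V p :
  scalar_profile eta Vm Vp E0 V p ->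
  scalar_profile eta (- Vp) (- Vm) E0 (fun y => - V (- y)) (fun y => p (- y)).
Proof.
  intros [Hnn Hd Hc Hf Hm Hp]; split.
  - intros y; replace ((- V (- y)) ^ 2) with (V (- y) ^ 2) by ring; apply Hnn.
  - intros y; evar_last.
    + apply (is_derive_opp (fun y => V (- y))), is_derive_comp_opp, Hd.
    + unfold opp; simpl; ring.
  - intros y; apply (continuous_comp Ropp p); [|apply Hc].
    apply (continuous_opp (fun y : R => y)), continuous_id.
  - intros y.
    set (q := fun w => eta (E0 - / 2 * V w ^ 2) * p w).
    apply (is_derive_ext (fun z => q (- z))).
    + intros z; unfold q.
      replace ((- V (- z)) ^ 2) with (V (- z) ^ 2) by ring; reflexivity.
    + evar_last; [apply (is_derive_comp_opp q), Hf|field].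
  - apply (is_lim_opp (fun y => V (- y)) m_infty Vp).
    apply (is_lim_comp V Ropp m_infty Vp p_infty); [exact Hp| |].
    + apply (is_lim_opp (fun y => y) m_infty m_infty), is_lim_id.
    + exists 0; intros; discriminate.
  - apply (is_lim_opp (fun y => V (- y)) p_infty Vm).
    apply (is_lim_comp V Ropp p_infty Vm m_infty); [exact Hm| |].
    + apply (is_lim_opp (fun y => y) p_infty p_infty), is_lim_id.
    + exists 0; intros; discriminate.
Qed.

Lemma diffusivity_continuous_pos (eta : R -> R) (w : R) :
  diffusivity eta -> 0 < w -> continuous eta w.
Proof.
  intros Heta Hw P HP.
  assert (H := diffusivity_continuous eta Heta w (Rlt_le _ _ Hw) P HP).
  unfold filtermap, within in *.
  apply (filter_imp (fun x => 0 < x < w + 1 /\ (0 <= x -> P (eta x)))).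
  - intros x [Hx HPx]; apply HPx; lra.
  - apply filter_and; [apply locally_between; lra|exact H].
Qed.

Lemma pow2_le_Rmax (Vm Vp v : R) :
  Vm <= v <= Vp -> v ^ 2 <= Rmax (Vm ^ 2) (Vp ^ 2).
Proof.
  intros Hv; destruct (Rle_dec 0 v).
  - apply Rle_trans with (2 := Rmax_r _ _); nra.
  - apply Rle_trans with (2 := Rmax_l _ _); nra.
Qed.

Lemma pow2_lt_Rmax (Vm Vp v : R) :
  Vm < v < Vp -> v ^ 2 < Rmax (Vm ^ 2) (Vp ^ 2).
Proof.
  intros Hv; destruct (Rle_dec 0 v).
  - apply Rlt_le_trans with (2 := Rmax_r _ _); nra.
  - apply Rlt_le_trans with (2 := Rmax_l _ _); nra.
Qed.

Lemma Rmax_pow2_opp (x y : R) :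
  Rmax ((- x) ^ 2) ((- y) ^ 2) = Rmax (x ^ 2) (y ^ 2).
Proof. f_equal; ring. Qed.

Section Profile.

Variables (eta : R -> R) (E0 : R).
Hypothesis Heta : diffusivity eta.

Lemma coefficient_continuous (v : R) :
  0 < E0 - / 2 * v ^ 2 -> continuous (fun u => eta (E0 - / 2 * u ^ 2)) v.
Proof.
  intros Hv; apply (continuous_comp (fun u => E0 - / 2 * u ^ 2) eta).
  - apply (ex_derive_continuous (fun u => E0 - / 2 * u ^ 2)); auto_derive; auto.
  - apply diffusivity_continuous_pos; assumption.
Qed.

Lemma coefficient_bounds (Vm Vp : R) :
  E0 > / 2 * Rmax (Vm ^ 2) (Vp ^ 2) -> Vm <= Vp ->
  exists m M, 0 < m /\
    forall v, Vm <= v <= Vp -> m <= eta (E0 - / 2 * v ^ 2) <= M.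
Proof.
  intros HE Hmp.
  assert (Hpos : forall v, Vm <= v <= Vp -> 0 < E0 - / 2 * v ^ 2).
  { intros v Hv; assert (H := pow2_le_Rmax Vm Vp v Hv); lra. }
  assert (Hc : forall v, Vm <= v <= Vp ->
            continuous (fun u => eta (E0 - / 2 * u ^ 2)) v)
    by (intros v Hv; apply coefficient_continuous, Hpos, Hv).
  destruct (exists_min_on _ Vm Vp Hmp Hc) as (c & Hcc & Hmin).
  destruct (exists_max_on _ Vm Vp Hmp Hc) as (d & Hdd & Hmax).
  exists (eta (E0 - / 2 * c ^ 2)), (eta (E0 - / 2 * d ^ 2)); split.
  - apply (diffusivity_pos eta Heta), Hpos, Hcc.
  - intros v Hv; split; [apply (Hmin v Hv)|apply (Hmax v Hv)].
Qed.

Lemma eventually_positive (V : R -> R) (Vp : R) :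
  is_lim V p_infty Vp -> 0 < E0 - / 2 * Vp ^ 2 ->
  exists N, forall y, N < y -> 0 < E0 - / 2 * V y ^ 2.
Proof.
  intros HV Hpos.
  assert (Hlim : filterlim (fun y => E0 - / 2 * V y ^ 2) (Rbar_locally' p_infty)
                   (locally (E0 - / 2 * Vp ^ 2))).
  { apply (filterlim_comp _ _ _ V (fun u => E0 - / 2 * u ^ 2) _ (locally Vp));
      [exact HV|].
    apply (ex_derive_continuous (fun u => E0 - / 2 * u ^ 2)); auto_derive; auto. }
  destruct (Hlim (fun z => 0 < z < E0 - / 2 * Vp ^ 2 + 1)) as (N & HN).
  { apply locally_between; lra. }
  exists N; intros y Hy; apply HN, Hy.
Qed.

(** On [y >= 0] the squared flux is nonincreasing. A zero of [W] at [y0 >= 0] is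
    a zero of the flux, which therefore vanishes for [y >= y0]; then [W] is zero
    there, and so is its limit. *)
Lemma scalar_profile_positive_right (Vm Vp : R) (V p : R -> R) :
  0 < E0 - / 2 * Vp ^ 2 -> scalar_profile eta Vm Vp E0 V p ->
  forall y, 0 <= y -> 0 < E0 - / 2 * V y ^ 2.
Proof.
  intros HVp HS y0 Hy0.
  set (W := fun y => E0 - / 2 * V y ^ 2).
  set (q := fun y => eta (W y) * p y).
  assert (Hnn : forall y, 0 <= W y) by apply (scalar_nonneg _ _ _ _ _ _ HS).
  destruct (Rle_lt_or_eq_dec 0 (W y0) (Hnn y0)) as [H|HW0]; [exact H|exfalso].
  assert (Hq : forall y, is_derive q y (- (y / 2) * p y))
    by apply (scalar_flux _ _ _ _ _ _ HS).
  assert (Hq0 : q y0 = 0).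
  { unfold q; rewrite <- HW0, (diffusivity_zero eta Heta); ring. }
  assert (Hqz : forall y, y0 <= y -> q y = 0).
  { intros y Hy.
    assert (Hle : - q y0 ^ 2 <= - q y ^ 2).
    { apply (nondecreasing_of_derive (fun z => - q z ^ 2)
               (fun z => z * (eta (W z) * p z ^ 2))); [exact Hy| |].
      - intros z Hz; split.
        + auto_derive; [exists (- (z / 2) * p z); apply Hq|].
          change (Derive (fun x => q x) z) with (Derive q z).
          rewrite (is_derive_unique _ _ _ (Hq z)); unfold q; field.
        + apply Rmult_le_pos; [lra|].
          apply Rmult_le_pos; [apply (diffusivity_nonneg eta Heta), Hnn|].
          apply pow2_ge_0.
      - intros z _; apply (ex_derive_continuous (fun z => - q z ^ 2)).
        auto_derive; exists (- (z / 2) * p z); apply Hq. }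
    rewrite Hq0 in Hle; assert (H := pow2_ge_0 (q y)).
    assert (Hq2 : q y * q y = 0) by nra.
    destruct (Rmult_integral _ _ Hq2); assumption. }
  assert (HWd : forall y, is_derive (fun z => W z ^ 2) y (- 2 * W y * V y * p y)).
  { intros y; assert (Hd := scalar_derive _ _ _ _ _ _ HS y).
    unfold W; auto_derive; [exists (p y); exact Hd|].
    change (Derive (fun x => V x) y) with (Derive V y).
    rewrite (is_derive_unique _ _ _ Hd); field. }
  assert (HW : forall y, y0 <= y -> W y = 0).
  { intros y Hy.
    assert (Heq : W y0 ^ 2 = W y ^ 2).
    { apply (constant_of_derive (fun z => W z ^ 2)
               (fun z => - 2 * W z * V z * p z)); [exact Hy| |].
      - intros z Hz; split; [apply HWd|].
        destruct (Rle_lt_or_eq_dec 0 (W z) (Hnn z)) as [Hpos|H0].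
        + assert (Hp : p z = 0).
          { assert (H := diffusivity_pos eta Heta _ Hpos).
            assert (Hz0 := Hqz z ltac:(lra)); unfold q in Hz0.
            destruct (Rmult_integral _ _ Hz0); lra. }
          rewrite Hp; ring.
        + rewrite <- H0; ring.
      - intros z _; eapply is_derive_continuous, HWd. }
    rewrite <- HW0 in Heq; assert (Hy2 : W y * W y = 0) by nra.
    destruct (Rmult_integral _ _ Hy2); assumption. }
  destruct (eventually_positive V Vp (scalar_plus _ _ _ _ _ _ HS) HVp) as (N & HN).
  set (z := Rmax y0 N + 1).
  assert (H1 := Rmax_l y0 N); assert (H2 := Rmax_r y0 N).
  specialize (HN z ltac:(unfold z; lra)).
  specialize (HW z ltac:(unfold z; lra)); unfold W in HW; lra.
Qed.

Lemma scalar_profile_positive (Vm Vp : R) (V p : R -> R) :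
  E0 > / 2 * Rmax (Vm ^ 2) (Vp ^ 2) -> scalar_profile eta Vm Vp E0 V p ->
  forall y, 0 < E0 - / 2 * V y ^ 2.
Proof.
  intros HE HS y.
  assert (H1 := Rmax_l (Vm ^ 2) (Vp ^ 2)); assert (H2 := Rmax_r (Vm ^ 2) (Vp ^ 2)).
  destruct (Rle_dec 0 y) as [Hy|Hy].
  - apply (scalar_profile_positive_right Vm Vp V p); [lra|exact HS|exact Hy].
  - assert (H := scalar_profile_positive_right _ _ _ _ ltac:(
      replace ((- Vm) ^ 2) with (Vm ^ 2) by ring; lra)
      (scalar_profile_rotate _ _ _ _ _ _ HS) (- y) ltac:(lra)).
    cbv beta in H; rewrite Ropp_involutive in H.
    replace ((- V y) ^ 2) with (V y ^ 2) in H by ring; exact H.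
Qed.

(** Once [W > 0], the flux [q] solves the linear equation
    [q' = - (y / (2 eta (W))) q], so it keeps its sign. *)
Lemma scalar_profile_sign (Vm Vp : R) (V p : R -> R) :
  E0 > / 2 * Rmax (Vm ^ 2) (Vp ^ 2) -> scalar_profile eta Vm Vp E0 V p ->
  (forall y, p y = 0) \/ (forall y, 0 < p y) \/ (forall y, p y < 0).
Proof.
  intros HE HS.
  assert (HW := scalar_profile_positive Vm Vp V p HE HS).
  set (A := fun y => eta (E0 - / 2 * V y ^ 2)).
  assert (HA : forall y, 0 < A y)
    by (intros y; apply (diffusivity_pos eta Heta), HW).
  assert (HAc : forall y, continuous A y).
  { intros y; apply (continuous_comp V (fun u => eta (E0 - / 2 * u ^ 2))).
    - eapply is_derive_continuous, (scalar_derive _ _ _ _ _ _ HS).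
    - apply coefficient_continuous, HW. }
  set (q := fun y => A y * p y).
  assert (Hq : forall y, is_derive q y (- (y / 2) * p y))
    by apply (scalar_flux _ _ _ _ _ _ HS).
  set (h := fun s => s * / (2 * A s)).
  assert (Hh : forall s, continuous h s).
  { intros s; apply (continuous_mult (fun s : R => s) (fun s => / (2 * A s)));
      [apply continuous_id|].
    apply (continuous_comp (fun s => 2 * A s) Rinv).
    - apply (continuous_mult (fun _ => 2) A); [apply continuous_const|apply HAc].
    - apply continuous_Rinv; specialize (HA s); lra. }
  (* [exp (I y)] is the integrating factor of the equation for [q]. *)
  set (I := (fun y => RInt h 0 y) : R -> R).
  assert (HI : forall y, is_derive I y (h y))
    by (intros y; apply is_derive_RInt_upper, Hh).
  assert (Hz : forall y, is_derive (fun z => q z * exp (I z)) y 0).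
  { intros y; clearbody I; auto_derive.
    - split; [exists (- (y / 2) * p y); apply Hq|].
      split; [exists (h y); apply HI|auto].
    - change (Derive (fun x => q x) y) with (Derive q y).
      change (Derive (fun x => I x) y) with (Derive I y).
      rewrite (is_derive_unique _ _ _ (Hq y)), (is_derive_unique _ _ _ (HI y)).
      unfold h, q; field; specialize (HA y); lra. }
  assert (Hconst : forall y, q y * exp (I y) = q 0 * exp (I 0)).
  { assert (Hle : forall x y, x <= y -> q x * exp (I x) = q y * exp (I y)).
    { intros x y Hxy.
      apply (constant_of_derive (fun z => q z * exp (I z)) (fun _ => 0));
        [exact Hxy| |].
      - intros z _; split; [apply Hz|reflexivity].
      - intros z _; eapply is_derive_continuous, Hz. }
    intros y; destruct (Rle_dec 0 y); [symmetry|]; apply Hle; lra. }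
  set (C := q 0 * exp (I 0)) in *.
  assert (Hp : forall y, p y = C * / (exp (I y) * A y)).
  { intros y; rewrite <- (Hconst y); unfold q.
    assert (H1 := exp_pos (I y)); specialize (HA y); field; lra. }
  assert (Hd : forall y, 0 < / (exp (I y) * A y)).
  { intros y; apply Rinv_0_lt_compat, Rmult_lt_0_compat; [apply exp_pos|apply HA]. }
  destruct (Rtotal_order C 0) as [HC|[HC|HC]].
  - right; right; intros y; rewrite Hp; specialize (Hd y); nra.
  - left; intros y; rewrite Hp, HC; ring.
  - right; left; intros y; rewrite Hp; specialize (Hd y); nra.
Qed.

Lemma scalar_profile_constant (Vm Vp : R) (V p : R -> R) :
  scalar_profile eta Vm Vp E0 V p -> (forall y, p y = 0) ->
  forall y, V y = Vm /\ V y = Vp.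
Proof.
  intros HS Hp y.
  assert (Hle : forall x z, x <= z -> V x = V z).
  { intros x z Hxz; apply (constant_of_derive V p); [exact Hxz| |].
    - intros w _; split; [apply (scalar_derive _ _ _ _ _ _ HS)|apply Hp].
    - intros w _; eapply is_derive_continuous, (scalar_derive _ _ _ _ _ _ HS). }
  assert (Hc : forall x, V y = V x).
  { intros x; destruct (Rle_dec y x); [|symmetry]; apply Hle; lra. }
  assert (Hlim : forall (b : Rbar) (l : R), is_lim V b l -> V y = l).
  { intros b l Hl.
    apply is_lim_unique in Hl.
    rewrite (Lim_ext (fun _ => V y) V b Hc) in Hl.
    rewrite Lim_const in Hl; injection Hl; auto. }
  split; [apply (Hlim m_infty), (scalar_minus _ _ _ _ _ _ HS)|].
  apply (Hlim p_infty), (scalar_plus _ _ _ _ _ _ HS).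
Qed.

Lemma scalar_profile_increasing (Vm Vp : R) (V p : R -> R) :
  scalar_profile eta Vm Vp E0 V p -> (forall y, 0 < p y) ->
  forall x y, x < y -> V x < V y.
Proof.
  intros HS Hp x y Hxy; apply (increasing_of_derive V p); [exact Hxy| |].
  - intros z _; split; [apply (scalar_derive _ _ _ _ _ _ HS)|apply Hp].
  - intros z _; eapply is_derive_continuous, (scalar_derive _ _ _ _ _ _ HS).
Qed.

Lemma scalar_profile_lt_right (Vm Vp : R) (V p : R -> R) :
  scalar_profile eta Vm Vp E0 V p -> (forall y, 0 < p y) -> forall y, V y < Vp.
Proof.
  intros HS Hp y.
  assert (Hincr := scalar_profile_increasing Vm Vp V p HS Hp).
  apply Rlt_le_trans with (V (y + 1)); [apply Hincr; lra|].
  assert (H : Rbar_le (V (y + 1)) Vp).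
  { apply (is_lim_le_loc (fun _ => V (y + 1)) V p_infty).
    - exists (y + 1); intros z Hz; left; apply Hincr, Hz.
    - apply is_lim_const.
    - apply (scalar_plus _ _ _ _ _ _ HS). }
  exact H.
Qed.

Lemma scalar_profile_between (Vm Vp : R) (V p : R -> R) :
  scalar_profile eta Vm Vp E0 V p -> (forall y, 0 < p y) ->
  forall y, Vm < V y < Vp.
Proof.
  intros HS Hp y; split; [|apply (scalar_profile_lt_right Vm Vp V p); assumption].
  assert (H := scalar_profile_lt_right _ _ _ _
    (scalar_profile_rotate _ _ _ _ _ _ HS) (fun z => Hp (- z)) (- y)).
  cbv beta in H; rewrite Ropp_involutive in H; lra.
Qed.

(** The flux is nonincreasing on [y >= 0]; a positive lower bound for it would
    bound [V'] from below and make [V] unbounded. *)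
Lemma scalar_profile_flux_small (Vm Vp : R) (V p : R -> R) :
  E0 > / 2 * Rmax (Vm ^ 2) (Vp ^ 2) ->
  scalar_profile eta Vm Vp E0 V p -> (forall y, 0 < p y) ->
  forall e, 0 < e ->
  exists N, forall y, N < y -> eta (E0 - / 2 * V y ^ 2) * p y < e.
Proof.
  intros HE HS Hp e He; apply NNPP; intros Hno.
  assert (Hbet := scalar_profile_between Vm Vp V p HS Hp).
  assert (Hmp : Vm < Vp) by (specialize (Hbet 0); lra).
  destruct (coefficient_bounds Vm Vp HE ltac:(lra)) as (m & M & Hm & HmM).
  assert (Hge : forall y, 0 <= y -> e <= eta (E0 - / 2 * V y ^ 2) * p y).
  { intros y Hy; apply Rnot_lt_le; intros Hlt; apply Hno; exists y; intros z Hz.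
    apply Rle_lt_trans with (2 := Hlt), Ropp_le_cancel.
    apply (nondecreasing_of_derive
      (fun z => - (eta (E0 - / 2 * V z ^ 2) * p z)) (fun z => - (- (z / 2) * p z)));
      [lra| |].
    - intros w Hw; split.
      + apply (is_derive_opp (fun z => eta (E0 - / 2 * V z ^ 2) * p z)).
        apply (scalar_flux _ _ _ _ _ _ HS).
      + specialize (Hp w); nra.
    - intros w _; apply (continuous_opp (fun z => eta (E0 - / 2 * V z ^ 2) * p z)).
      eapply is_derive_continuous, (scalar_flux _ _ _ _ _ _ HS). }
  assert (HM : 0 < M).
  { assert (H := HmM (V 0)); specialize (Hbet 0); lra. }
  set (T := (Vp - Vm) * M / e).
  assert (HT : 0 < T) by (apply Rdiv_lt_0_compat; nra).
  destruct (mean_value V p 0 T HT) as (c & Hc & Heq).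
  - intros z _; apply (scalar_derive _ _ _ _ _ _ HS).
  - intros z _; eapply is_derive_continuous, (scalar_derive _ _ _ _ _ _ HS).
  - assert (Hpc : e <= M * p c).
    { apply Rle_trans with (1 := Hge c ltac:(lra)).
      apply Rmult_le_compat_r; [specialize (Hp c); lra|].
      apply HmM; specialize (Hbet c); lra. }
    assert (HTe : T * e = (Vp - Vm) * M) by (unfold T; field; lra).
    assert (H : Vp - Vm <= p c * T).
    { apply Rmult_le_reg_r with M; [exact HM|].
      rewrite <- HTe; nra. }
    assert (H0 := Hbet 0); assert (H1 := Hbet T); lra.
Qed.

Lemma exists_max_vanishing (D : R -> R) (y0 : R) :
  (forall y, continuous D y) ->
  (forall e, 0 < e -> exists N, forall y, N < y -> D y < e /\ D (- y) < e) ->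
  0 < D y0 -> exists y1, 0 < D y1 /\ forall y, D y <= D y1.
Proof.
  intros Hc Hv H0.
  destruct (Hv (D y0) H0) as (N & HN).
  set (K := Rmax (Rabs N) (Rabs y0) + 1).
  assert (HK1 := Rmax_l (Rabs N) (Rabs y0)); assert (HK2 := Rmax_r (Rabs N) (Rabs y0)).
  assert (HN1 := Rle_abs N); assert (Hy1 := Rle_abs y0).
  assert (Hy2 := Rle_abs (- y0)); rewrite Rabs_Ropp in Hy2.
  assert (HNp := Rabs_pos N).
  destruct (exists_max_on D (- K) K) as (y1 & Hy & Hmax).
  - unfold K; lra.
  - intros; apply Hc.
  - assert (Hge : D y0 <= D y1) by (apply Hmax; unfold K; lra).
    exists y1; split; [lra|]; intros y.
    destruct (Rle_dec (- K) y) as [Hl|Hl]; [destruct (Rle_dec y K) as [Hr|Hr]|].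
    + apply Hmax; lra.
    + apply Rle_trans with (2 := Hge); left; apply HN; unfold K in *; lra.
    + apply Rle_trans with (2 := Hge); left.
      rewrite <- (Ropp_involutive y); apply HN; unfold K in *; lra.
Qed.

(** The hodograph identity: along an increasing profile the flux is the function
    [Q] of [V]. The difference [D] of both satisfies [D' = p E] with
    [E' = D / (2 Q)], which forbids positive maxima and negative minima, and it
    vanishes at both ends of the line. *)
Lemma scalar_profile_hodograph (Vm Vp : R) (V p Q : R -> R) :
  E0 > / 2 * Rmax (Vm ^ 2) (Vp ^ 2) ->
  scalar_profile eta Vm Vp E0 V p -> (forall y, 0 < p y) ->
  singular_solution (fun v => eta (E0 - / 2 * v ^ 2)) Vm Vp Q ->
  forall y, Derive Q (V y) = - (y / 2).
Proof.
  intros HE HS Hp (HQc & HQl & HQh & HQ).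
  assert (Hbet := scalar_profile_between Vm Vp V p HS Hp).
  assert (HdV := scalar_derive _ _ _ _ _ _ HS).
  set (q := fun y => eta (E0 - / 2 * V y ^ 2) * p y).
  assert (Hq : forall y, is_derive q y (- (y / 2) * p y))
    by apply (scalar_flux _ _ _ _ _ _ HS).
  assert (Hqpos : forall y, 0 < q y).
  { intros y; apply Rmult_lt_0_compat; [|apply Hp].
    apply (diffusivity_pos eta Heta).
    apply (scalar_profile_positive Vm Vp V p HE HS). }
  set (D := fun y => q y - Q (V y)).
  set (E := fun y => - (y / 2) - Derive Q (V y)).
  assert (HD : forall y, is_derive D y (p y * E y)).
  { intros y; evar_last.
    - apply (is_derive_minus q (fun y => Q (V y))); [apply Hq|].
      apply (is_derive_comp Q V); [exact (proj1 (proj2 (HQ _ (Hbet y))))|apply HdV].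
    - unfold E, minus, plus, opp, scal; simpl; unfold mult; simpl; ring. }
  assert (HEd : forall y, is_derive E y (D y / (2 * Q (V y)))).
  { intros y; destruct (HQ (V y) (Hbet y)) as (H0 & _ & H2); evar_last.
    - apply (is_derive_minus (fun y => - (y / 2)) (fun y => Derive Q (V y)) y (- / 2)).
      + auto_derive; [auto|field].
      + apply (is_derive_comp (Derive Q) V); [exact H2|apply HdV].
    - unfold D, q, minus, plus, opp, scal; simpl; unfold mult; simpl; field; lra. }
  assert (Hsmall : forall e, 0 < e -> exists N, forall y, N < y ->
            Rabs (D y) < e /\ Rabs (D (- y)) < e).
  { intros e He.
    destruct (scalar_profile_flux_small Vm Vp V p HE HS Hp e He) as (N1 & HN1).
    assert (HEr : E0 > / 2 * Rmax ((- Vp) ^ 2) ((- Vm) ^ 2)).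
    { replace ((- Vm) ^ 2) with (Vm ^ 2) by ring.
      replace ((- Vp) ^ 2) with (Vp ^ 2) by ring.
      rewrite Rmax_comm; exact HE. }
    destruct (scalar_profile_flux_small _ _ _ _ HEr
      (scalar_profile_rotate _ _ _ _ _ _ HS) (fun z => Hp (- z)) e He)
      as (N2 & HN2).
    assert (HQlim : forall (b : Rbar) (l : R), is_lim V b l -> Q l = 0 ->
              Rbar_locally' b (fun y => Q (V y) < e)).
    { intros b l Hl H0.
      assert (Hl' : filterlim (fun y => Q (V y)) (Rbar_locally' b)
                      (locally (Q l))).
      { apply (filterlim_comp _ _ _ V Q _ (locally l)); [exact Hl|apply HQc]. }
      rewrite H0 in Hl'.
      assert (H := Hl' (fun z => - e < z < e) (locally_between (- e) e 0 ltac:(lra))).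
      unfold filtermap in H; revert H; apply filter_imp; intros z Hz; lra. }
    destruct (HQlim p_infty Vp (scalar_plus _ _ _ _ _ _ HS) HQh) as (N3 & HN3).
    destruct (HQlim m_infty Vm (scalar_minus _ _ _ _ _ _ HS) HQl) as (N4 & HN4).
    exists (Rmax (Rmax N1 N2) (Rmax N3 (- N4))); intros y Hy.
    assert (Hy1 := Rmax_l (Rmax N1 N2) (Rmax N3 (- N4))).
    assert (Hy2 := Rmax_r (Rmax N1 N2) (Rmax N3 (- N4))).
    assert (Hy3 := Rmax_l N1 N2); assert (Hy4 := Rmax_r N1 N2).
    assert (Hy5 := Rmax_l N3 (- N4)); assert (Hy6 := Rmax_r N3 (- N4)).
    specialize (HN1 y ltac:(lra)); specialize (HN2 y ltac:(lra)).
    specialize (HN3 y ltac:(lra)); specialize (HN4 (- y) ltac:(lra)).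
    cbv beta in HN2; replace ((- V (- y)) ^ 2) with (V (- y) ^ 2) in HN2 by ring.
    assert (G1 := Hqpos y); assert (G2 := Hqpos (- y)).
    assert (G3 := proj1 (HQ (V y) (Hbet y))).
    assert (G4 := proj1 (HQ (V (- y)) (Hbet (- y)))).
    unfold D, q in *; split; apply Rabs_def1; lra. }
  (* [s = 1] excludes positive maxima of [D], [s = - 1] negative minima. *)
  assert (Hsign : forall s, s = 1 \/ s = - 1 -> forall y, s * D y <= 0).
  { intros s Hs y; apply Rnot_lt_le; intros Hpos.
    assert (Hsabs : forall z, s * z <= Rabs z).
    { intros z; destruct Hs as [->| ->].
      - rewrite Rmult_1_l; apply Rle_abs.
      - replace (-1 * z) with (- z) by ring; rewrite <- Rabs_Ropp; apply Rle_abs. }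
    destruct (exists_max_vanishing (fun z => s * D z) y) as (y1 & H1 & Hmax).
    - intros z; apply (continuous_mult (fun _ => s) D); [apply continuous_const|].
      eapply is_derive_continuous, HD.
    - intros e He; destruct (Hsmall e He) as (N & HN); exists N; intros z Hz.
      destruct (HN z Hz) as (Ha & Hb).
      split; (eapply Rle_lt_trans; [apply Hsabs|assumption]).
    - exact Hpos.
    - assert (HsD : forall z, is_derive (fun w => s * D w) z (p z * (s * E z))).
      { intros z; evar_last; [apply is_derive_scal, HD|ring]. }
      apply (no_local_max (fun z => s * D z) p (fun z => s * E z) y1
               (s * (D y1 / (2 * Q (V y1)))) 1); [lra| | | |].
      + intros z _; split; [apply HsD|split; [apply Hp|apply Hmax]].
      + assert (Hz : p y1 * (s * E y1) = 0).
        { apply (interior_max_derive_zero (fun z => s * D z) (y1 - 1) (y1 + 1) y1);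
            [lra|apply HsD|intros; apply Hmax]. }
        specialize (Hp y1); destruct (Rmult_integral _ _ Hz); lra.
      + apply is_derive_scal, HEd.
      + replace (s * (D y1 / (2 * Q (V y1)))) with (s * D y1 / (2 * Q (V y1)))
          by (unfold Rdiv; ring).
        assert (G := proj1 (HQ (V y1) (Hbet y1))).
        apply Rdiv_lt_0_compat; lra. }
  assert (HD0 : forall y, D y = 0).
  { intros y; assert (H1 := Hsign 1 (or_introl eq_refl) y).
    assert (H2 := Hsign (- 1) (or_intror eq_refl) y); lra. }
  intros y.
  assert (Hz : p y * E y = 0).
  { rewrite <- (is_derive_unique _ _ _ (HD y)).
    rewrite (Derive_ext D (fun _ => 0)) by exact HD0; apply Derive_const. }
  assert (HEy : E y = 0).
  { specialize (Hp y); destruct (Rmult_integral _ _ Hz); lra. }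
  unfold E in HEy; lra.
Qed.

End Profile.

(** * Existence and uniqueness of profiles *)

Section Solve.

Variables (eta : R -> R) (E0 : R).
Hypothesis Heta : diffusivity eta.

Lemma hodograph_function_exists (Vm Vp : R) :
  E0 > / 2 * Rmax (Vm ^ 2) (Vp ^ 2) -> Vm < Vp ->
  exists Q, singular_solution (fun v => eta (E0 - / 2 * v ^ 2)) Vm Vp Q.
Proof.
  intros HE Hmp.
  destruct (coefficient_bounds eta E0 Heta Vm Vp HE ltac:(lra))
    as (m & M & Hm & HmM).
  assert (Hcl : forall x, Vm <= clamp Vm Vp x <= Vp)
    by (intros; apply clamp_between; lra).
  destruct (singular_solution_exists
    (fun v => eta (E0 - / 2 * clamp Vm Vp v ^ 2)) Vm Vp m M Hmp Hm) as (Q & HQ).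
  - intros x; apply HmM, Hcl.
  - intros x; apply (continuous_comp (clamp Vm Vp)
                       (fun u => eta (E0 - / 2 * u ^ 2)));
      [apply continuous_clamp|].
    apply coefficient_continuous; [exact Heta|].
    assert (H := pow2_le_Rmax Vm Vp _ (Hcl x)); lra.
  - exists Q; revert HQ; apply singular_solution_ext; intros x Hx.
    rewrite clamp_id by lra; reflexivity.
Qed.

(** The profile is the inverse of [v |-> - 2 Q' v], which maps [(Vm, Vp)] onto
    the line. *)
Lemma profile_of_hodograph (Vm Vp : R) (Q : R -> R) :
  E0 > / 2 * Rmax (Vm ^ 2) (Vp ^ 2) -> Vm < Vp ->
  singular_solution (fun v => eta (E0 - / 2 * v ^ 2)) Vm Vp Q ->
  exists V p, scalar_profile eta Vm Vp E0 V p /\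
    (forall y, Vm < V y < Vp /\ Derive Q (V y) = - (y / 2)).
Proof.
  intros HE Hmp HQs.
  set (a := fun v => eta (E0 - / 2 * v ^ 2)) in *.
  destruct (coefficient_bounds eta E0 Heta Vm Vp HE ltac:(lra))
    as (m & M & Hm & HmM); fold a in HmM.
  assert (Ham : forall v, Vm < v < Vp -> m <= a v) by (intros; apply HmM; lra).
  assert (Hapos : forall v, Vm < v < Vp -> 0 < a v)
    by (intros v Hv; specialize (Ham v Hv); lra).
  assert (Hac : forall v, Vm < v < Vp -> continuous a v).
  { intros v Hv; apply coefficient_continuous; [exact Heta|].
    assert (H := pow2_le_Rmax Vm Vp v ltac:(lra)); lra. }
  assert (Honto := singular_solution_slope_onto a Q Vm Vp m Hmp Hm Ham HQs).
  assert (Hdec := singular_solution_slope_decreasing a Q Vm Vp Hapos HQs).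
  destruct HQs as (HQc & _ & _ & HQ).
  set (V := fun y => proj1_sig
              (constructive_indefinite_description _ (Honto (- (y / 2))))).
  assert (HV : forall y, Vm < V y < Vp /\ Derive Q (V y) = - (y / 2)).
  { intros y; unfold V.
    exact (proj2_sig (constructive_indefinite_description _ (Honto (- (y / 2))))). }
  clearbody V.
  set (Y := fun v => - 2 * Derive Q v).
  assert (HYV : forall y, Y (V y) = y).
  { intros y; unfold Y; rewrite (proj2 (HV y)); field. }
  (* comparison of [V] with a level [v] is comparison of [y] with [Y v] *)
  assert (Hgt : forall v y, Vm < v < Vp -> Y v < y -> v < V y).
  { intros v y Hv Hy; apply Rnot_le_lt; intros Hle.
    rewrite <- (HYV y) in Hy; unfold Y in Hy.
    destruct Hle as [Hlt|Heq]; [|rewrite Heq in Hy; lra].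
    assert (H := Hdec (V y) v (proj1 (proj1 (HV y))) Hlt (proj2 Hv)); lra. }
  assert (Hlt : forall v y, Vm < v < Vp -> y < Y v -> V y < v).
  { intros v y Hv Hy; apply Rnot_le_lt; intros Hle.
    rewrite <- (HYV y) in Hy; unfold Y in Hy.
    destruct Hle as [Hlt|Heq]; [|rewrite Heq in Hy; lra].
    assert (H := Hdec v (V y) (proj1 Hv) Hlt (proj2 (proj1 (HV y)))); lra. }
  assert (Hmono : forall u v, Vm < u -> u < v -> v < Vp -> Y u < Y v).
  { intros u v Hu Huv Hv; assert (H := Hdec u v Hu Huv Hv); unfold Y; lra. }
  assert (HVc : forall y, continuous V y).
  { intros y; apply continuous_epsilon; intros e He.
    destruct (HV y) as (Hy & _).
    set (d := Rmin e (Rmin ((V y - Vm) / 2) ((Vp - V y) / 2)) / 2).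
    assert (Hd : 0 < d /\ d < e /\ d < V y - Vm /\ d < Vp - V y).
    { assert (0 < Rmin e (Rmin ((V y - Vm) / 2) ((Vp - V y) / 2)))
        by (repeat apply Rmin_pos; lra).
      assert (H1 := Rmin_l e (Rmin ((V y - Vm) / 2) ((Vp - V y) / 2))).
      assert (H2 := Rmin_r e (Rmin ((V y - Vm) / 2) ((Vp - V y) / 2))).
      assert (H3 := Rmin_l ((V y - Vm) / 2) ((Vp - V y) / 2)).
      assert (H4 := Rmin_r ((V y - Vm) / 2) ((Vp - V y) / 2)).
      unfold d; lra. }
    clearbody d.
    assert (H1 := Hmono (V y - d) (V y) ltac:(lra) ltac:(lra) ltac:(lra)).
    assert (H2 := Hmono (V y) (V y + d) ltac:(lra) ltac:(lra) ltac:(lra)).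
    rewrite HYV in H1, H2.
    exists (Rmin (y - Y (V y - d)) (Y (V y + d) - y)); split.
    { apply Rmin_pos; lra. }
    intros z Hz; apply Rabs_def2 in Hz.
    assert (H3 := Rmin_l (y - Y (V y - d)) (Y (V y + d) - y)).
    assert (H4 := Rmin_r (y - Y (V y - d)) (Y (V y + d) - y)).
    assert (H5 := Hgt (V y - d) z ltac:(lra) ltac:(lra)).
    assert (H6 := Hlt (V y + d) z ltac:(lra) ltac:(lra)).
    apply Rabs_def1; lra. }
  set (p := fun y => Q (V y) * / a (V y)).
  assert (HVd : forall y, is_derive V y (p y)).
  { intros y; destruct (HV y) as (Hy & _); destruct (HQ (V y) Hy) as (H0 & _ & H2).
    assert (Hay := Hapos (V y) Hy).
    replace (p y) with (/ (a (V y) / Q (V y))) by (unfold p; field; lra).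
    apply (is_derive_right_inverse Y V y); [exact HYV|apply HVc| |].
    - evar_last; [apply (is_derive_scal (Derive Q)), H2|field; lra].
    - apply Rgt_not_eq, Rdiv_lt_0_compat; assumption. }
  exists V, p; split; [|exact HV]; split.
  - intros y; assert (H := pow2_le_Rmax Vm Vp (V y) ltac:(destruct (HV y); lra)).
    lra.
  - exact HVd.
  - intros y; destruct (HV y) as (Hy & _).
    apply (continuous_mult (fun y => Q (V y)) (fun y => / a (V y))).
    + apply (continuous_comp V Q); [apply HVc|apply HQc].
    + apply (continuous_comp (fun y => a (V y)) Rinv).
      * apply (continuous_comp V a); [apply HVc|apply Hac, Hy].
      * apply continuous_Rinv; specialize (Hapos _ Hy); lra.
  - intros y; apply (is_derive_ext (fun y => Q (V y))).
    + intros z; specialize (Hapos _ (proj1 (HV z))); unfold p.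
      change (Q (V z) = a (V z) * (Q (V z) * / a (V z))); field; lra.
    + destruct (HV y) as (Hy & HD); evar_last.
      * apply (is_derive_comp Q V); [exact (proj1 (proj2 (HQ _ Hy)))|apply HVd].
      * rewrite HD; unfold scal; simpl; unfold mult; simpl; ring.
  - apply is_lim_spec; intros e.
    set (v := Rmin ((Vm + Vp) / 2) (Vm + e / 2)).
    assert (He := cond_pos e).
    assert (Hv : Vm < v < Vp /\ v < Vm + e).
    { assert (H1 := Rmin_l ((Vm + Vp) / 2) (Vm + e / 2)).
      assert (H2 := Rmin_r ((Vm + Vp) / 2) (Vm + e / 2)).
      assert (Vm < v) by (apply Rmin_glb_lt; lra).
      fold v in H1, H2; lra. }
    exists (Y v); intros y Hy.
    specialize (Hlt v y ltac:(lra) Hy); destruct (HV y) as (H & _).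
    apply Rabs_def1; lra.
  - apply is_lim_spec; intros e.
    set (v := Rmax ((Vm + Vp) / 2) (Vp - e / 2)).
    assert (He := cond_pos e).
    assert (Hv : Vm < v < Vp /\ Vp - e < v).
    { assert (H1 := Rmax_l ((Vm + Vp) / 2) (Vp - e / 2)).
      assert (H2 := Rmax_r ((Vm + Vp) / 2) (Vp - e / 2)).
      assert (v < Vp) by (apply Rmax_lub_lt; lra).
      fold v in H1, H2; lra. }
    exists (Y v); intros y Hy.
    specialize (Hgt v y ltac:(lra) Hy); destruct (HV y) as (H & _).
    apply Rabs_def1; lra.
Qed.

Lemma scalar_profile_monotone (Vm Vp : R) (V p : R -> R) :
  E0 > / 2 * Rmax (Vm ^ 2) (Vp ^ 2) -> scalar_profile eta Vm Vp E0 V p ->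
  Vm < Vp -> forall y, 0 < p y.
Proof.
  intros HE HS Hmp.
  destruct (scalar_profile_sign eta E0 Heta Vm Vp V p HE HS) as [H|[H|H]].
  - destruct (scalar_profile_constant eta E0 Vm Vp V p HS H 0); lra.
  - exact H.
  - assert (Hp : forall y, 0 < - p y) by (intros y; specialize (H y); lra).
    assert (Hb := scalar_profile_between eta E0 _ _ _ _
                    (scalar_profile_opp _ _ _ _ _ _ HS) Hp 0); lra.
Qed.

Lemma scalar_profile_exists_unique_increasing (Vm Vp : R) :
  E0 > / 2 * Rmax (Vm ^ 2) (Vp ^ 2) -> Vm < Vp ->
  exists V p, scalar_profile eta Vm Vp E0 V p /\
    forall V1 p1, scalar_profile eta Vm Vp E0 V1 p1 -> forall y, V1 y = V y.
Proof.
  intros HE Hmp.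
  destruct (hodograph_function_exists Vm Vp HE Hmp) as (Q & HQ).
  destruct (profile_of_hodograph Vm Vp Q HE Hmp HQ) as (V & p & HS & HV).
  exists V, p; split; [exact HS|]; intros V1 p1 HS1 y.
  assert (Hp1 := scalar_profile_monotone Vm Vp V1 p1 HE HS1 Hmp).
  assert (HD := scalar_profile_hodograph eta E0 Heta Vm Vp V1 p1 Q HE HS1 Hp1 HQ y).
  assert (Hb := scalar_profile_between eta E0 Vm Vp V1 p1 HS1 Hp1 y).
  destruct (HV y) as (Hb' & HD').
  assert (Ha : forall x, Vm < x < Vp -> 0 < eta (E0 - / 2 * x ^ 2)).
  { intros x Hx; apply (diffusivity_pos eta Heta).
    assert (H := pow2_lt_Rmax Vm Vp x Hx); lra. }
  assert (Hdec := singular_solution_slope_decreasing _ Q Vm Vp Ha HQ).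
  destruct (Rtotal_order (V1 y) (V y)) as [H|[H|H]]; [|exact H|].
  - apply Hdec in H; lra.
  - apply Hdec in H; lra.
Qed.

Lemma scalar_profile_exists_unique (Vm Vp : R) :
  E0 > / 2 * Rmax (Vm ^ 2) (Vp ^ 2) ->
  exists V p, scalar_profile eta Vm Vp E0 V p /\
    forall V1 p1, scalar_profile eta Vm Vp E0 V1 p1 -> forall y, V1 y = V y.
Proof.
  intros HE.
  destruct (Rtotal_order Vm Vp) as [H|[H|H]].
  - apply scalar_profile_exists_unique_increasing; assumption.
  - subst Vp; exists (fun _ => Vm), (fun _ => 0); split.
    + split.
      * intros _; assert (H := Rmax_l (Vm ^ 2) (Vm ^ 2)); lra.
      * intros y; apply (is_derive_const Vm).
      * intros y; apply continuous_const.
      * intros y; apply (is_derive_ext (fun _ => 0)).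
        -- intros z; symmetry; apply Rmult_0_r.
        -- evar_last; [apply (is_derive_const 0)|symmetry; apply Rmult_0_r].
      * apply is_lim_const.
      * apply is_lim_const.
    + intros V1 p1 HS1 y.
      destruct (scalar_profile_sign eta E0 Heta Vm Vm V1 p1 HE HS1) as [H|[H|H]].
      * apply (scalar_profile_constant eta E0 Vm Vm V1 p1 HS1 H).
      * assert (Hb := scalar_profile_between eta E0 Vm Vm V1 p1 HS1 H y); lra.
      * assert (Hp : forall z, 0 < - p1 z) by (intros z; specialize (H z); lra).
        assert (Hb := scalar_profile_between eta E0 _ _ _ _
                        (scalar_profile_opp _ _ _ _ _ _ HS1) Hp y); lra.
  - destruct (scalar_profile_exists_unique_increasing (- Vm) (- Vp))
      as (V & p & HS & HU); [rewrite Rmax_pow2_opp; exact HE|lra|].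
    apply scalar_profile_opp in HS; rewrite !Ropp_involutive in HS.
    exists (fun y => - V y), (fun y => - p y); split; [exact HS|].
    intros V1 p1 HS1 y.
    rewrite <- (HU _ _ (scalar_profile_opp _ _ _ _ _ _ HS1) y); ring.
Qed.

(** The equation for [W] follows from the one for [V]: the energy identity gives
    [W' = - V V'], hence [eta (W) W' = - V q]. *)
Lemma connecting_of_scalar (Vm Vp : R) (V p : R -> R) :
  scalar_profile eta Vm Vp E0 V p ->
  connecting_profile eta eta Vm Vp E0 V (fun y => E0 - / 2 * V y ^ 2).
Proof.
  intros [Hnn HV Hpc Hq Hm Hp].
  set (W := fun y => E0 - / 2 * V y ^ 2).
  set (q := fun y => eta (W y) * p y).
  change (forall y, is_derive q y (- (y / 2) * p y)) in Hq.
  assert (HVD : forall y, Derive V y = p y)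
    by (intros; apply is_derive_unique, HV).
  assert (HVc : forall y, continuous V y)
    by (intros y; eapply is_derive_continuous, HV).
  assert (HW : forall y, is_derive W y (- (V y * p y))).
  { intros y; unfold W; auto_derive; [exists (p y); apply HV|].
    change (Derive (fun x => V x) y) with (Derive V y); rewrite HVD; field. }
  assert (HWD : forall y, Derive W y = - (V y * p y))
    by (intros; apply is_derive_unique, HW).
  assert (HVf : forall y, is_derive (flux eta W V) y (- (y / 2) * p y)).
  { intros y; apply (is_derive_ext q); [|apply Hq].
    intros z; unfold flux; rewrite HVD; reflexivity. }
  assert (HWf : forall y, is_derive (flux eta W W) y
            (y / 2 * (V y * p y) - q y * p y)).
  { intros y; apply (is_derive_ext (fun z => - (V z * q z))).
    - intros z; unfold flux, q; rewrite HWD.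
      change (- (V z * (eta (W z) * p z)) = eta (W z) * - (V z * p z)); ring.
    - auto_derive; [split; [exists (p y); apply HV|split; [eexists; apply Hq|auto]]|].
      change (Derive (fun x => V x) y) with (Derive V y).
      change (Derive (fun x => q x) y) with (Derive q y).
      rewrite HVD, (is_derive_unique _ _ _ (Hq y)); field. }
  assert (HC1 : forall f f' : R -> R, (forall y, is_derive f y (f' y)) ->
            (forall y, continuous f' y) -> is_C1 f).
  { intros f f' Hf Hf' y; split; [exists (f' y); apply Hf|].
    apply (continuous_ext f'); [|apply Hf'].
    intros z; symmetry; apply is_derive_unique, Hf. }
  assert (Hhalf : forall y : R, continuous (fun z => z / 2) y).
  { intros y; apply (ex_derive_continuous (fun z => z / 2)); auto_derive; auto. }
  assert (HVp : forall y, continuous (fun z => V z * p z) y)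
    by (intros y; apply (continuous_mult V p); auto).
  split; [split|exact Hm|exact Hp|intros y; unfold W; ring].
  - exact Hnn.
  - apply (HC1 V p); assumption.
  - apply (HC1 W (fun y => - (V y * p y)) HW).
    intros y; apply (continuous_opp (fun z => V z * p z)), HVp.
  - apply (HC1 _ _ HVf).
    intros y; apply (continuous_mult (fun z => - (z / 2)) p); [|apply Hpc].
    apply (continuous_opp (fun z => z / 2)), Hhalf.
  - apply (HC1 _ _ HWf); intros y.
    apply (continuous_minus (fun y => y / 2 * (V y * p y)) (fun y => q y * p y)).
    + apply (continuous_mult (fun y => y / 2) (fun y => V y * p y)); auto.
    + apply (continuous_mult q p); [|apply Hpc].
      eapply is_derive_continuous, Hq.
  - intros y; rewrite HVD, (is_derive_unique _ _ _ (HVf y)); reflexivity.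
  - intros y; rewrite HWD, HVD, (is_derive_unique _ _ _ (HWf y)); unfold q; ring.
Qed.

Lemma scalar_of_connecting (Vm Vp : R) (V W : R -> R) :
  connecting_profile eta eta Vm Vp E0 V W ->
  scalar_profile eta Vm Vp E0 V (Derive V) /\
  forall y, W y = E0 - / 2 * V y ^ 2.
Proof.
  intros [[Hnn HV1 HW1 HVf HWf HVe HWe] Hm Hp HE].
  assert (HW : forall y, W y = E0 - / 2 * V y ^ 2)
    by (intros y; specialize (HE y); lra).
  split; [|exact HW]; split; try assumption.
  - intros y; rewrite <- HW; apply Hnn.
  - intros y; apply Derive_correct, HV1.
  - intros y; apply HV1.
  - intros y; apply (is_derive_ext (flux eta W V)).
    + intros z; unfold flux; rewrite HW; reflexivity.
    + rewrite HVe; apply Derive_correct, HVf.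
Qed.

Lemma increasing_profile_bounds (Vm Vp : R) (V p : R -> R) :
  E0 > / 2 * Rmax (Vm ^ 2) (Vp ^ 2) -> scalar_profile eta Vm Vp E0 V p ->
  Vm < Vp ->
  strict_increasing V /\
  forall y, E0 - / 2 * V y ^ 2 > E0 - / 2 * Rmax (Vm ^ 2) (Vp ^ 2).
Proof.
  intros HE HS Hmp.
  assert (Hp := scalar_profile_monotone Vm Vp V p HE HS Hmp).
  split.
  - intros x y Hxy; apply (scalar_profile_increasing eta E0 Vm Vp V p HS Hp); auto.
  - intros y; assert (H := pow2_lt_Rmax Vm Vp (V y)
      (scalar_profile_between eta E0 Vm Vp V p HS Hp y)); lra.
Qed.

End Solve.

Theorem theorem2p1 (eta : R -> R) (Heta : diffusivity eta) (Vm Vp E0 : R)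
  (HE0 : E0 > / 2 * Rmax (Vm ^ 2) (Vp ^ 2)) :
  exists V W : R -> R,
    connecting_profile eta eta Vm Vp E0 V W /\
    (forall V1 W1 : R -> R, connecting_profile eta eta Vm Vp E0 V1 W1 ->
       forall y, V1 y = V y /\ W1 y = W y) /\
    (Vm <> Vp ->
       (strict_increasing V \/ strict_decreasing V) /\
       forall y, W y > E0 - / 2 * Rmax (Vm ^ 2) (Vp ^ 2) /\
                 E0 - / 2 * Rmax (Vm ^ 2) (Vp ^ 2) > 0).
Proof.
  destruct (scalar_profile_exists_unique eta E0 Heta Vm Vp HE0)
    as (V & p & HS & HU).
  exists V, (fun y => E0 - / 2 * V y ^ 2); split; [|split].
  - apply (connecting_of_scalar eta E0 Vm Vp V p HS).
  - intros V1 W1 HC y.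
    destruct (scalar_of_connecting eta E0 Vm Vp V1 W1 HC) as (HS1 & HW1).
    assert (H := HU V1 _ HS1 y); rewrite HW1, H; split; reflexivity.
  - intros Hne.
    destruct (Rdichotomy _ _ Hne) as [Hlt|Hgt].
    + destruct (increasing_profile_bounds eta E0 Heta Vm Vp V p HE0 HS Hlt)
        as (Hmono & HW).
      split; [left; exact Hmono|intros y; split; [apply HW|lra]].
    + assert (HE : E0 > / 2 * Rmax ((- Vm) ^ 2) ((- Vp) ^ 2))
        by (rewrite Rmax_pow2_opp; exact HE0).
      destruct (increasing_profile_bounds eta E0 Heta _ _ _ _ HE
                  (scalar_profile_opp _ _ _ _ _ _ HS) ltac:(lra)) as (Hmono & HW).
      split.
      * right; intros x y Hxy; specialize (Hmono x y Hxy); cbv beta in Hmono; lra.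
      * intros y; specialize (HW y); rewrite Rmax_pow2_opp in HW.
        replace ((- V y) ^ 2) with (V y ^ 2) in HW by ring; split; lra.
Qed.
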